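(* Let $G$ be a locally compact Hausdorff group that is second-countable and unimodular, with Haar measure $\mu_G$. Let $\Gamma$ be a discrete subgroup of $G$, $\Lambda$ a subgroup of $\Gamma$, and $\chi:\Gamma\to\mathbb C^\times$ a unitary character. Let $\varphi:G\to\mathbb C$ be a measurable function such that (F1) $\varphi(\lambda g)=\chi(\lambda)\varphi(g)$ for all $\lambda\in\Lambda$, $g\in G$; (F2) $|\varphi|\in L^1(\Lambda\backslash G)$. Then $$\int_{\Gamma\backslash G}\left|P_{\Lambda\backslash\Gamma,\chi}\varphi\right|\,d\mu_{\Gamma\backslash G}>0$$ if there exists a Borel measurable set $C\subseteq G$ with the following properties: (C1) $CC^{-1}\cap\Gamma\subseteq\Lambda$. (C2) Writing $(\Lambda C)^c:=G\setminus\Lambda C$, we have $$\int_{\Lambda\backslash\Lambda C}\rho(\varphi)\,d\mu_{\Lambda\backslash G}>\int_{\Lambda\backslash(\Lambda C)^c}\rho(\varphi)\,d\mu_{\Lambda\backslash G}$$ for some measurable function $\rho:\mathbb C\to\mathbb R_{\geq0}$ with the following properties: (M1) $\rho(0)=0$; (M2) $\rho(z)=\rho(|z|)$ for all $z\in\mathbb C$; (M3) $\rho\left(\sum_{n=1}^\infty z_n\right)\leq\sum_{n=1}^\infty\rho(z_n)$ for every sequence $(z_n)_{n\in\mathbb Z_{>0}}\subseteq\mathbb C$ such that $\sum_{n=1}^\infty|z_n|<\infty$.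
   Context: For a discrete subgroup $\Delta$ of $G$ (used for $\Delta=\Gamma$ and $\Delta=\Lambda$), $\mu_{\Delta\backslash G}$ denotes the unique Radon measure on $\Delta\backslash G$ such that $\int_{\Delta\backslash G}\sum_{\delta\in\Delta}\phi(\delta g)\,d\mu_{\Delta\backslash G}(g)=\int_G\phi\,d\mu_G$ for all $\phi\in C_c(G)$. The space $L^1(\Delta\backslash G)$ is defined with respect to this measure. Left $\Delta$-invariant functions on $G$ are identified with functions on $\Delta\backslash G$; by (F1) and (M2), $|\varphi|$ and $\rho(\varphi):=\rho\circ\varphi$ are left $\Lambda$-invariant. The Poincaré series of $\varphi$ is $$(P_{\Lambda\backslash\Gamma,\chi}\varphi)(g):=\sum_{\gamma\in\Lambda\backslash\Gamma}\overline{\chi(\gamma)}\,\varphi(\gamma g),\qquad g\in G.$$ Under (F1) and (F2) it is known that this series converges absolutely for almost every $g\in G$, that $(P_{\Lambda\backslash\Gamma,\chi}\varphi)(\gamma\,\cdot\,)=\chi(\gamma)P_{\Lambda\backslash\Gamma,\chi}\varphi$ for $\gamma\in\Gamma$, and that $|P_{\Lambda\backslash\Gamma,\chi}\varphi|\in L^1(\Gamma\backslash G)$. *)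

(* Defs.v *)
From HB Require Import structures.
From mathcomp Require Import all_boot all_order all_algebra.
From mathcomp Require Import generic_quotient complex.
From mathcomp Require Import all_classical all_reals all_analysis.
From mathcomp Require summability.

Set Implicit Arguments.
Unset Strict Implicit.
Unset Printing Implicit Defensive.

Import Order.TTheory GRing.Theory Num.Theory.
Import numFieldNormedType.Exports.

Local Open Scope classical_set_scope.
Local Open Scope ring_scope.

HB.mixin Record isTopologicalGroup G of Group G & Topological G := {
  mulg_continuous : continuous (fun xy : G * G => (xy.1 * xy.2)%g);
  invg_continuous : continuous (fun x : G => (x^-1)%g)
}.

(* Pointedness is only there because measurable types are pointed. *)
#[short(type="topologicalGroupType")]
HB.structure Definition TopologicalGroup :=
  {G of Group G & PointedTopological G & isTopologicalGroup G}.

Definition borel (T : ptopologicalType) := g_sigma_algebraType (@open T).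
HB.instance Definition _ (T : ptopologicalType) :=
  Measurable.on (borel T).

(* Folland's definition; [compact] does not include Hausdorff, but it is only
   used on Hausdorff spaces. *)
Definition radon (R : realType) (T : ptopologicalType)
    (mu : {measure set (borel T) -> \bar R}) : Prop :=
  [/\ forall K : set T, compact K -> (mu K < +oo)%E,
      forall A : set (borel T), measurable A ->
        mu A = ereal_inf [set mu U | U in [set U : set T | open U /\ A `<=` U]]
    & forall U : set T, open U ->
        mu U = ereal_sup [set mu K | K in [set K : set T | compact K /\ K `<=` U]]].

Section groups.
Context (R : realType) (G : topologicalGroupType).
Implicit Types (mu : {measure set (borel G) -> \bar R}) (D : groupClosed G).

Definition left_invariant mu : Prop :=
  forall (g : G) (A : set (borel G)), measurable A ->
    mu [set (g * x)%g | x in A] = mu A.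

Definition right_invariant mu : Prop :=
  forall (g : G) (A : set (borel G)), measurable A ->
    mu [set (x * g)%g | x in A] = mu A.

Definition haar_measure mu : Prop :=
  [/\ radon mu, mu [set: G] != 0%E & left_invariant mu].

Definition unimodular : Prop :=
  forall mu, haar_measure mu -> right_invariant mu.

Definition discrete_subgroup D : Prop := [set` D] `<=` isolated [set` D].

(* D x = D y iff x y^-1 lies in D *)
Definition coset_rel D : rel G := fun x y => (x / y)%g \in D.

Lemma coset_rel_equiv D : equiv_class_of (coset_rel D).
Proof.
split=> [x|x y|y x z]; rewrite /coset_rel.
- by rewrite divgg gpred1.
- by rewrite gpredFC.
- move=> xy yz.
  by rewrite -(mulgVK y x) -mulgA gpredM.
Qed.

Canonical coset_equiv D := EquivRelPack (coset_rel_equiv D).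

(* the space D \ G of right cosets D g, with the quotient topology *)
Definition coset_space D := quotient_topology {eq_quot coset_equiv D}%qT.
HB.instance Definition _ D := Quotient.on (coset_space D).
HB.instance Definition _ D := PointedTopological.on (coset_space D).

Definition coset_pi D (g : G) : coset_space D := \pi_(coset_space D)%qT g.

(* A left D-invariant function f on G is, as a function on D \ G,
   x |-> f (repr x). *)

(* The D-sum has finitely many nonzero terms, D being closed and discrete and f
   compactly supported. Taking f real-valued loses nothing, as complex
   integrals are computed componentwise. *)
Definition quotient_measure D mu
    (nu : {measure set (borel (coset_space D)) -> \bar R}) : Prop :=
  radon nu /\
  forall f : G -> R, continuous f -> compact (closure [set g | f g != 0]) ->
    (\int[nu]_(x in [set: coset_space D])
        (\sum_(d \in [set` D]) f (d * repr x)%g)%:E =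
     \int[mu]_(g in [set: G]) (f g)%:E)%E.

Definition unitary_character D (chi : G -> R[i]) : Prop :=
  {in D &, {morph chi : x y / (x * y)%g >-> x * y}} /\
  {in D, forall d, `|chi d| = 1}.

(* The index set L \ D is the image of D in L \ G; outside it the summand is
   [point], which is 0 in R[i]^o. The sum is the limit along the finite sets of
   indices, so it converges iff it converges absolutely; where it does not, its
   value is 0 by convention. *)
Definition poincare_series (L D : groupClosed G) (chi phi : G -> R[i])
    (g : G) : R[i] :=
  summability.sum
    (((fun x : coset_space L =>
        (chi (repr x))^*%C * phi (repr x * g)%g : R[i]^o)
      \_ (coset_pi L @` [set` D])) : coset_space L -> R[i]^o).

End groups.

(* Main.v *)
Require Import Defs.
From HB Require Import structures.
From mathcomp Require Import all_boot all_order all_algebra.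
From mathcomp Require Import generic_quotient complex.
From mathcomp Require Import finmap ring.
From mathcomp Require Import all_classical all_reals all_analysis.
From mathcomp Require Import measurable_realfun.
From mathcomp Require summability.
Import Order.TTheory GRing.Theory Num.Theory.
Import numFieldNormedType.Exports.
Local Open Scope classical_set_scope.
Local Open Scope ring_scope.

(** Choose a Borel fundamental domain [F] of [Gamma]. The translates of [F] by
    representatives of [Lambda \ Gamma] make up a fundamental domain of
    [Lambda], so the integral over [Lambda \ G] of a left [Lambda]-invariant
    [f >= 0] is the integral over [F] of the sum of [f (gamma g)] over
    [Lambda \ Gamma]. If the integral of [|P phi|] vanished, then for almost
    every [g] in [F] the series [P phi g] would be absolutely convergent with
    sum 0. By (C1) at most one of the points [gamma g] lies in [Lambda C]; the
    corresponding term is minus the sum of all the others, so (M1)-(M3) bound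
    the sum of [rho (phi (gamma g))] over the [gamma g] in [Lambda C] by the sum
    over the other ones. Integrating over [F] contradicts (C2). *)

(** [quotient_measure] prescribes integrals of continuous compactly supported functions only,
    whereas the argument needs the quotient measures on Borel sets. They are therefore compared with
    [mu] on slices: open, relatively compact sets on which the projection is injective. For a
    function supported in a slice the sum over the subgroup has at most one nonzero term, so Urysohn
    functions and regularity identify the two measures there. Countably many slices cover [G];
    sorting the cosets by the first slice that they meet also yields the Borel fundamental domain.
    Both quotient integrals thus become integrals of [mu] over the same set [F], where they can be
    compared pointwise.

    Measurability needs care: [repr] is an arbitrary choice of representatives, and the Poincare
    series is an unordered sum. The first is replaced by a Borel section, the second by an ordinary
    series on the set of absolute convergence. *)

Set Implicit Arguments.
Unset Strict Implicit.

(* [e] is partial so that finite sets can be enumerated too. *)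
Definition enumerates {T : Type} (S : set T) (e : nat -> option T) :=
  [/\ forall n x, e n = Some x -> S x,
      forall x, S x -> exists n, e n = Some x
    & forall n m x, e n = Some x -> e m = Some x -> n = m].

(** Read an injection into [nat] backwards: [e n] is the element of [S] with code [n], if there is
    one. *)
Lemma countable_enumerates {T : pointedType} (S : set T) :
  countable S -> exists e, enumerates S e.
Proof.
move=> /countable_injP[f finj].
pose P n x := S x /\ f x = n.
exists (fun n => if pselect (exists x, P n x) is left h then Some (sval (cid h))
                 else None); split.
- by move=> n x; case: pselect => // h [<-]; case: cid => y [].
- move=> x Sx; exists (f x); case: pselect => [h|]; last by case; exists x.
  case: cid => y [Sy fxy] /=; congr Some.
  by apply: finj => //; rewrite inE.
- move=> n m x; case: pselect => // hn; case: pselect => // hm.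
  case: cid => y [_ fy] /= [yx]; case: cid => z [_ fz] /= [zx].
  by rewrite -fy -fz yx zx.
Qed.

(** * Topological groups and discrete subgroups *)

Section group_topology.
Context (G : topologicalGroupType).
Implicit Types (D : groupClosed G) (a g x y : G).

Lemma mulgl_continuous a : continuous (fun x : G => (a * x)%g).
Proof.
move=> x; apply: (@continuous_comp _ _ _ (fun x => (a, x))
  (fun xy : G * G => (xy.1 * xy.2)%g)); last exact: mulg_continuous.
by apply: cvg_pair => //=; exact: cvg_cst.
Qed.

Lemma mulgr_continuous a : continuous (fun x : G => (x * a)%g).
Proof.
move=> x; apply: (@continuous_comp _ _ _ (fun x => (x, a))
  (fun xy : G * G => (xy.1 * xy.2)%g)); last exact: mulg_continuous.
by apply: cvg_pair => //=; exact: cvg_cst.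
Qed.

Lemma image_mulgl a (A : set G) :
  [set (a * x)%g | x in A] = (fun x => (a^-1 * x)%g) @^-1` A.
Proof.
apply/seteqP; split=> [_ [x Ax <-]|x Ax] /=; first by rewrite mulKg.
by exists (a^-1 * x)%g => //; rewrite mulVKg.
Qed.

Lemma coset_piP {D x y} : coset_pi D x = coset_pi D y <-> (x / y)%g \in D.
Proof.
split=> [h|h].
  have /eqP : coset_pi D x == coset_pi D y by apply/eqP.
  by rewrite /coset_pi => /eqquotP.
by rewrite /coset_pi; apply/eqquotP.
Qed.

Lemma coset_pi_repr D (u : coset_space D) : coset_pi D (repr u) = u.
Proof. exact: reprK. Qed.

Lemma repr_coset_pi D g : exists2 d, d \in D & repr (coset_pi D g) = (d * g)%g.
Proof.
exists (repr (coset_pi D g) / g)%g; last by rewrite mulgVK.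
by apply/coset_piP; rewrite coset_pi_repr.
Qed.

Lemma coset_piM D d g : d \in D -> coset_pi D (d * g)%g = coset_pi D g.
Proof. by move=> dD; apply/coset_piP; rewrite mulgK. Qed.

Lemma coset_pi_continuous D : continuous (coset_pi D : G -> coset_space D).
Proof. exact: (@pi_continuous _ {eq_quot coset_equiv D}%qT). Qed.

(** The set of all points equivalent to a point of [U] is the union of the translates [d U], each of
    them open. *)
Lemma coset_pi_open D (U : set G) : open U -> open (coset_pi D @` U).
Proof.
move=> oU; rewrite /open/= /quotient_open.
rewrite (_ : _ @^-1` _ = \bigcup_(d in [set` D]) [set (d * x)%g | x in U]).
  apply: bigcup_open => d _; rewrite image_mulgl.
  by apply: open_comp => // x _; exact: mulgl_continuous.
apply/seteqP; split=> [g [u Uu /esym/coset_piP guD]|_ [d dD [u Uu <-]]] /=.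
  by exists (g / u)%g => //; exists u => //; rewrite mulgVK.
by exists u => //; apply/esym/coset_piM.
Qed.

(* Over [V] the projection to [D \ G] is a homeomorphism onto an open image. *)
Definition slice D (V : set G) :=
  open V /\ forall x y, V x -> V y -> (x / y)%g \in D -> x = y.

Lemma slice_inj D V x y :
  slice D V -> V x -> V y -> coset_pi D x = coset_pi D y -> x = y.
Proof. by move=> [_ h] Vx Vy /coset_piP; exact: h. Qed.

(** Discreteness gives a neighbourhood [N] of 1 that meets [D] only in 1, and continuity of division
    a neighbourhood [U] of 1 with quotients in [N]. Right translates [U g] inherit this, since
    quotients x/y do not change under right translation. Second countability reduces the translates
    to countably many basic open sets. *)
Lemma exists_slices D : locally_compact [set: G] -> @second_countable G ->
  discrete_subgroup D ->
  exists V : nat -> set G, [/\ (forall n, slice D (V n)),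
    forall n, exists2 K, compact K & V n `<=` K
  & \bigcup_n V n = setT].
Proof.
move=> lc [B cB [Bo Bn]] /(_ 1%g)[|_ [N nN ND]]; first exact: gpred1.
have [L L1 [cL _]] := lc 1%g I.
rewrite withinET in L1.
have [[P Q]/= [nP nQ] PQN] : nbhs ((1%g : G), (1%g : G))
    ((fun xy => (xy.1 / xy.2)%g) @^-1` N).
  pose h := (fun xy : G * G => (xy.1, xy.2^-1)%g).
  have hc : {for ((1%g : G), (1%g : G)), continuous h}.
    apply: cvg_pair => /=; first exact: cvg_fst.
    by apply: (cvg_comp _ _ (@cvg_snd _ _ _ _ _)); exact: invg_continuous.
  have := continuous_comp hc (@mulg_continuous G (h (1, 1)%g)).
  by apply; rewrite /h/= invg1 mulg1.
pose U := P `&` Q `&` L.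
have nU : nbhs (1%g : G) U by apply: filterI => //; exact: filterI.
have UD x y : U x -> U y -> (x / y)%g \in D -> x = y.
  move=> [[Px _] _] [[_ Qy] _] xyD.
  have : (N `&` [set` D]) (x / y)%g by split => //; apply: (PQN (x, y)).
  by rewrite ND => /= /eqP; rewrite divg_eq1 => /eqP.
pose good (W : set G) := slice D W /\ exists2 K, compact K & W `<=` K.
have [|e [eB Be _]] := @countable_enumerates _ (B `&` good).
  exact: (sub_countable (subset_card_le (@subIsetl _ _ _))).
exists (fun n => odflt set0 (e n)); split=> [n|n|].
- case: (e n) (eB n) => [W /(_ _ erefl)[_ []]//|_ /=].
  by split; [exact: open0|].
- case: (e n) (eB n) => [W /(_ _ erefl)[_ []]//|_ /=].
  by exists set0; [exact: compact0|].
- apply/seteqP; split=> // g _.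
  have nUg : nbhs g [set x | U (x / g)%g].
    apply: mulgr_continuous; rewrite mulgV; exact: nU.
  have [W [BW Wg] WU] := Bn _ _ nUg.
  have [|n en] := Be W; last by exists n => //; rewrite en.
  split=> //; split.
    split; first exact: Bo.
    move=> x y /WU Wx /WU Wy xyD; apply: (@mulIg _ g^-1%g); apply: UD => //.
    by rewrite mulgKA.
  exists [set (x * g)%g | x in L].
    apply: continuous_compact => //; apply: continuous_subspaceT.
    exact: mulgr_continuous.
  by move=> x /WU [_ Lx]; exists (x / g)%g => //; rewrite mulgVK.
Qed.

(** A slice contains at most one element of [D], so the index of a slice containing it determines an
    element of [D]. *)
Lemma discrete_countable D : locally_compact [set: G] -> @second_countable G ->
  discrete_subgroup D -> countable [set` D].
Proof.
move=> lc sc dD; have [V [Vs _ VT]] := exists_slices lc sc dD.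
have ex g : exists n, V n g by have : setT g by []; rewrite -VT => -[n]; exists n.
apply/countable_injP; exists (fun g => sval (cid (ex g))) => x y.
rewrite !inE /= => xD yD; case: cid => n /= Vx; case: cid => m /= Vy nm.
by subst m; apply: (proj2 (Vs n)) => //; rewrite gpredF.
Qed.

Lemma discrete_subset D D' : {subset D' <= D} -> discrete_subgroup D ->
  discrete_subgroup D'.
Proof.
move=> sD dD x xD'; have [_ [V nV VD]] := dD x (sD _ xD').
split; first by rewrite inE.
exists V => //; apply/seteqP; split=> [y [Vy yD']|_ ->].
  have : (V `&` [set` D]) y by split => //; exact: sD.
  by rewrite VD.
by split=> //; have : [set x] x by []; rewrite -VD => -[].
Qed.

End group_topology.

(** * Integrals and Borel measurability *)

(** The integral of a nonnegative function is a supremum over the simple functions below it, so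
    monotonicity holds without measurability. It is applied to sums over [D] and to the modulus of
    the Poincare series, for which measurability is not established. *)
Lemma ge0_le_integralT d (T : measurableType d) (R : realType)
    (mu : {measure set T -> \bar R}) (f g : T -> \bar R) :
  (forall x, 0 <= f x)%E -> (forall x, f x <= g x)%E ->
  (\int[mu]_x f x <= \int[mu]_x g x)%E.
Proof.
move=> f0 fg; have g0 x : (0 <= g x)%E := le_trans (f0 x) (fg x).
rewrite !ge0_integralTE//; apply: ereal_sup_le => _ [h hf <-].
by exists h => // x; exact: le_trans (hf x) (fg x).
Qed.

(** Here [nu] is the image under [p] of [mu] restricted to [D], and the complement of [D] is null
    for that restriction. *)
Lemma integral_image_measure d1 d2 (X : measurableType d1)
    (Y : measurableType d2) (R : realType) (p : X -> Y) (D : set X)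
    (mu : {measure set X -> \bar R}) (nu : {measure set Y -> \bar R})
    (f : Y -> \bar R) :
  measurable_fun setT p -> measurable D ->
  (forall A, measurable A -> nu A = mu (p @^-1` A `&` D)) ->
  measurable_fun setT f -> (forall y, 0 <= f y)%E ->
  (\int[nu]_y f y = \int[mu]_(x in D) f (p x))%E.
Proof.
move=> mp mD nuE mf f0.
pose muD := [the {measure set X -> \bar R} of mrestr mu mD].
pose nu' : {measure set Y -> \bar R} :=
  @measure_function_pushforward__canonical__measure_function_Measure
    _ _ _ _ _ muD p mp.
rewrite (eq_measure_integral nu'); last by move=> A mA _; rewrite nuE.
rewrite (ge0_integral_pushforward mp muD measurableT mf)//= preimage_setT.
have mfp : measurable_fun setT (f \o p) by exact: measurableT_comp.
rewrite -[setT](setUv D) ge0_integral_setU//; last 3 first.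
- exact: measurableC.
- by rewrite setUv.
- by apply/disj_setPS; rewrite setICr.
rewrite [X in (_ + X)%E](eq_measure_integral mzero).
  rewrite integral_measure_zero adde0.
  apply: eq_measure_integral => A mA AD.
  by rewrite /= /mrestr setIidl.
move=> A mA /disjoints_subset AD.
by rewrite /= /mrestr AD measure0.
Qed.

(** The one-point compactification is compact Hausdorff, hence normal. There [K] is separated from
    the closed set formed by [B] and the point at infinity. *)
Lemma compact_urysohn (R : realType) (T : topologicalType) (K B : set T) :
  locally_compact [set: T] -> hausdorff_space T ->
  compact K -> closed B -> K `&` B = set0 ->
  exists f : T -> R, [/\ continuous f, forall x, 0 <= f x <= 1,
    forall x, K x -> f x = 1 & forall x, B x -> f x = 0].
Proof.
move=> lc T2 cK cB KB.
pose opc := one_point_compactification T.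
have T2opc : hausdorff_space opc by exact: one_point_compactification_hausdorff.
have /(@uniform_separatorP opc R)[f [fc f01 f0 f1]] :
    uniform_separator (~` (Some @` (~` B)) : set opc) (Some @` K).
  apply: normal_uniform_separator.
  - by apply: compact_normal => //; exact: one_point_compactification_compact.
  - apply: open_closedC; apply: one_point_compactification_open_some.
    exact: closed_openC.
  - apply: compact_closed => //; apply: continuous_compact => //.
    apply: continuous_subspaceT.
    exact: one_point_compactification_some_continuous.
  - apply/disjoints_subset => x Bx [k Kk kx]; apply: Bx; exists k => // Bk.
    by have : (K `&` B) k by []; rewrite KB.
exists (f \o Some); split.
- move=> x; apply: continuous_comp; last exact: fc.
  exact: one_point_compactification_some_continuous.
- move=> x; have : f (Some x) \in `[0, 1] by apply: f01; exists (Some x).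
  by rewrite in_itv.
- by move=> x Kx; apply: f1; exists (Some x) => //; exists x.
- by move=> x Bx; apply: f0; exists (Some x) => // -[y nBy [xy]]; apply: nBy; rewrite xy.
Qed.

Lemma open_borel (T : ptopologicalType) (U : set T) :
  open U -> measurable (U : set (borel T)).
Proof. by move=> oU; exact: sub_sigma_algebra. Qed.

Lemma continuous_borel (T U : ptopologicalType) (f : T -> U) :
  continuous f -> measurable_fun setT (f : borel T -> borel U).
Proof.
move=> /continuousP fc; apply: (@measurability _ _ (borel T) (borel U)
  setT f (@open U) erefl).
by move=> _ [V oV <-]; rewrite setTI; apply: open_borel; exact: fc.
Qed.

Lemma continuous_borel_real (R : realType) (T : ptopologicalType) (f : T -> R) :
  continuous f -> measurable_fun setT (f : borel T -> R).
Proof.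
move=> /continuousP fc; apply: (measurability _ (RGenOpens.measurableE R)).
move=> _ [_ [a [b ->]] <-]; rewrite setTI; apply: open_borel; apply: fc.
exact: interval_open.
Qed.

(** * The quotient measure as an integral over a fundamental domain *)

Section slices.
Context (R : realType) (G : topologicalGroupType) (D : groupClosed G).
Implicit Types (V : set G) (f : G -> R).

Lemma measurable_coset_pi :
  measurable_fun setT (coset_pi D : borel G -> borel (coset_space D)).
Proof. by apply: continuous_borel; exact: coset_pi_continuous. Qed.

(** On [V] the projection has a continuous inverse. In terms of filters: the image of [F] clusters
    at some [coset_pi D v] with [v] in [V]; openness of the projection turns neighbourhoods of [v]
    into neighbourhoods of that coset, and injectivity on [V] brings the meeting points back to
    [G]. *)
Lemma slice_compact V (K : set (coset_space D)) : slice D V ->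
  compact K -> K `<=` coset_pi D @` V -> compact (coset_pi D @^-1` K `&` V).
Proof.
move=> sV cK KV F PF FK.
have [x [Kx clx]] : K `&` cluster (coset_pi D @ F) !=set0.
  apply: cK; rewrite /fmap/=; apply: filterS FK => g [] //.
have [v Vv vx] := KV _ Kx; subst x.
exists v; split=> // A B FA Bv.
have FAK : F (A `&` (coset_pi D @^-1` K `&` V)) by exact: filterI.
have oV : open V by case: sV.
have nB : nbhs (coset_pi D v) (coset_pi D @` (B^° `&` V)).
  apply: open_nbhs_nbhs; split.
    by apply: coset_pi_open; apply: openI => //; exact: open_interior.
  by exists v => //; split => //; exact: nbhs_interior.
have FA' : F (coset_pi D @^-1` (coset_pi D @` (A `&` (coset_pi D @^-1` K `&` V)))).
  by apply: filterS FAK => g Ag; exists g.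
have [_ [[a [Aa [Ka Va]] <-] [b [Bb Vb] ab]]] := clx _ _ FA' nB.
exists a; split => //; rewrite (slice_inj sV Va Vb); last exact/esym.
exact: interior_subset.
Qed.

(** If the representative of the coset is [d0 v], then [d d0 v] lies in [V] only for the inverse [d]
    of [d0]. *)
Lemma sum_slice V f v : slice D V -> (forall g, ~ V g -> f g = 0) -> V v ->
  \sum_(d \in [set` D]) f (d * repr (coset_pi D v))%g = f v.
Proof.
move=> [oV sV] f0 Vv; have [d0 d0D ->] := repr_coset_pi D v.
rewrite -(@fsbig_widen _ _ _ _ [set d0^-1%g])/=.
- by rewrite fsbig_set1 mulKg.
- by move=> _ ->/=; rewrite gpredV.
- move=> d [/= dD dd0]; apply: f0 => Vd; apply: dd0.
  have /eqP : (d * (d0 * v))%g = v.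
    by apply: sV => //; rewrite mulgA mulgK gpredM.
  by rewrite mulgA -{2}(mul1g v) => /eqP/mulIg/eqP; rewrite mulg_eq1 => /eqP.
Qed.

Lemma sum_slice0 V f x : (forall g, ~ V g -> f g = 0) ->
  ~ (coset_pi D @` V) x -> \sum_(d \in [set` D]) f (d * repr x)%g = 0.
Proof.
move=> f0 nVx; apply: fsbig1 => d /= dD; apply: f0 => Vd; apply: nVx.
by exists (d * repr x)%g => //; rewrite coset_piM// coset_pi_repr.
Qed.

End slices.

Section quotient_measure.
Context (R : realType) (G : topologicalGroupType).
Hypotheses (G_lc : locally_compact [set: G]) (G_T2 : hausdorff_space G).
Context (mu : {measure set (borel G) -> \bar R}) (mu_radon : radon mu).
Context (D : groupClosed G).
Context (nu : {measure set (borel (coset_space D)) -> \bar R}).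
Hypothesis nuP : quotient_measure mu nu.
Implicit Types (V : set G).

(** Both measures are inner regular on open sets. For a compact set inside either open set, a
    Urysohn function that is 1 on it (or on its lift) and 0 off [W] has the same integral upstairs
    and downstairs, which gives one inequality each. *)
Let slice_open V (L : set G) (O : set (coset_space D)) :
  slice D V -> compact L -> V `<=` L -> open O -> O `<=` coset_pi D @` V ->
  nu O = mu (coset_pi D @^-1` O `&` V).
Proof.
move=> sV cL VL oO OV; set W := _ `&` V.
have oV : open V by case: sV.
have oW : open W.
  by apply: openI => //; apply: open_comp => // x _; exact: coset_pi_continuous.
have transfer (f : G -> R) : continuous f -> (forall g, ~ W g -> f g = 0) ->
    (\int[nu]_x (\sum_(d \in [set` D]) f (d * repr x)%g)%:E =
     \int[mu]_g (f g)%:E)%E.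
  move=> fc fW; apply: (proj2 nuP) => //.
  apply: (subclosed_compact _ cL); first exact: closed_closure.
  rewrite (closure_id L).1; last exact: compact_closed.
  apply: closureS => g /= fg; apply: VL; apply: contrapT => nVg.
  by move/eqP: fg; apply; apply: fW => -[].
have fV (f : G -> R) : (forall g, ~ W g -> f g = 0) ->
    forall g, ~ V g -> f g = 0 by move=> fW g nVg; apply: fW => -[].
have urysohn (K : set G) : compact K -> K `<=` W -> exists f : G -> R,
    [/\ continuous f, forall x, 0 <= f x <= 1, forall x, K x -> f x = 1
      & forall x, ~ W x -> f x = 0].
  move=> cK KW; apply: compact_urysohn => //; first exact: open_closedC.
  by apply/disjoints_subset; rewrite setCK.
apply/eqP; rewrite eq_le; apply/andP; split.
- have [_ _ ->] := proj1 nuP => //; apply: ge_ereal_sup => _ [K [cK KO] <-].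
  pose K' := coset_pi D @^-1` K `&` V.
  have cK' : compact K' by apply: slice_compact => // x /KO/OV.
  have K'W : K' `<=` W by move=> g [Kg Vg]; split => //; exact: KO.
  (* No Hausdorff property of [D \ G] is at hand to make [K] closed. *)
  have mK : measurable (K : set (borel (coset_space D))).
    (* The set removed is open, as the image of the open set [V] minus the closed set [K']. *)
    have -> : K = coset_pi D @` V `\` coset_pi D @` (V `\` K').
      apply/seteqP; split=> [x Kx|_ [[v Vv <-] nK]].
        split; first by apply/OV/KO.
        move=> [g [Vg K'g] gx]; apply: K'g; split => //.
        by rewrite /= gx.
      by apply: contrapT => nKv; apply: nK; exists v => //; split => // -[].
    apply: measurableD; apply: open_borel; apply: coset_pi_open => //.
    by rewrite setDE; apply: openI => //; apply: closed_openC; exact: compact_closed.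
  have [f [fc f01 f1 f0]] := urysohn K' cK' K'W.
  have -> : nu K = (\int[nu]_x (\1_K x)%:E)%E by rewrite integral_indic// setIT.
  have -> : mu W = (\int[mu]_x (\1_W x)%:E)%E.
    by rewrite integral_indic ?setIT//; exact: open_borel.
  apply: (@le_trans _ _ (\int[mu]_g (f g)%:E)%E).
    rewrite -transfer//; apply: ge0_le_integralT => x.
      by rewrite lee_fin.
    rewrite lee_fin indicE; have [|Kx] := boolP (x \in K).
      rewrite inE => /[dup] Kx /KO/OV[v Vv vx]; rewrite -vx.
      rewrite (sum_slice sV)//; last exact: fV.
      by rewrite f1//; split => //=; rewrite vx.
    by apply: fsumr_ge0 => d _; case/andP: (f01 (d * repr x)%g).
  apply: ge0_le_integralT => g.
    by rewrite lee_fin; case/andP: (f01 g).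
  rewrite lee_fin indicE; have [|] := boolP (g \in W).
    by case/andP: (f01 g).
  by rewrite notin_setE => /f0 ->.
- have [_ _ ->] := mu_radon => //; apply: ge_ereal_sup => _ [K [cK KW] <-].
  have [f [fc f01 f1 f0]] := urysohn K cK KW.
  have mK : measurable (K : set (borel G)).
    rewrite -[K]setCK; apply: measurableC; apply: open_borel.
    by apply: closed_openC; exact: compact_closed.
  have -> : mu K = (\int[mu]_x (\1_K x)%:E)%E by rewrite integral_indic// setIT.
  have -> : nu O = (\int[nu]_x (\1_O x)%:E)%E.
    by rewrite integral_indic ?setIT//; exact: open_borel.
  apply: (@le_trans _ _ (\int[mu]_g (f g)%:E)%E).
    apply: ge0_le_integralT => g; rewrite lee_fin//.
    rewrite indicE; have [|_] := boolP (g \in K); last by case/andP: (f01 g).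
    by rewrite inE => /f1 ->.
  rewrite -transfer//; apply: ge0_le_integralT => x; rewrite lee_fin.
    by apply: fsumr_ge0 => d _; case/andP: (f01 (d * repr x)%g).
  rewrite indicE; have [|] := boolP (x \in O).
    rewrite inE => /OV[v Vv <-].
    rewrite (sum_slice sV)//; last exact: fV.
    by case/andP: (f01 v).
  rewrite notin_setE => nOx; rewrite (@sum_slice0 _ _ _ W)//.
  by move=> [g [/= + _] gx]; rewrite gx.
Qed.

(** Both sides are measures in [A] that agree on open sets, a generating family closed under
    intersections. Relative compactness of [V] makes them finite, as uniqueness of measures
    requires. *)
Lemma slice_measure V (L : set G) (A : set (borel (coset_space D))) :
  slice D V -> compact L -> V `<=` L -> measurable A ->
  nu (A `&` coset_pi D @` V) = mu (coset_pi D @^-1` A `&` V).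
Proof.
move=> sV cL VL mA.
have oV : open V by case: sV.
have mV := open_borel oV.
have mpV := open_borel (@coset_pi_open _ D _ oV).
pose m1 := [the {measure set (borel (coset_space D)) -> \bar R} of mrestr nu mpV].
pose muV := [the {measure set (borel G) -> \bar R} of mrestr mu mV].
pose m2 : {measure set (borel (coset_space D)) -> \bar R} :=
  @measure_function_pushforward__canonical__measure_function_Measure
    _ _ _ _ _ muV _ (@measurable_coset_pi G D).
have m12 (O : set (coset_space D)) : open O -> m1 O = m2 O.
  move=> oO; rewrite /m1 /= /mrestr (slice_open sV cL VL).
  - rewrite /pushforward /muV /= /mrestr; congr (mu _).
    apply/seteqP; split => [g [[Og _] Vg]//|g [Og Vg]].
    by split => //; split => //; exists g.
  - by apply: openI => //; exact: coset_pi_open.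
  - by move=> x [].
suff : m1 A = m2 A by [].
apply: (@measure_unique _ _ (borel (coset_space D)) (@open (coset_space D))
  (fun=> setT)) => //.
- by move=> ? ? ? ?; exact: openI.
- by move=> _; exact: openT.
- by rewrite bigcup_const.
- move=> _; rewrite m12; last exact: openT.
  rewrite /= /pushforward /mrestr /= preimage_setT setTI.
  have mL : measurable (L : set (borel G)).
    rewrite -[L]setCK; apply: measurableC; apply: open_borel.
    by apply: closed_openC; exact: compact_closed.
  apply: (@le_lt_trans _ _ (mu L)); first by apply: le_measure; rewrite ?inE.
  by have [Kfin _ _] := mu_radon; exact: Kfin.
Qed.

End quotient_measure.

(** * Borel fundamental domains *)

Section fundamental_domain.
Context (G : topologicalGroupType) (D : groupClosed G).

Definition fundamental_domain (F : set (borel G)) := [/\ measurable F,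
  forall g, exists2 d, d \in D & F (d * g)%g
& forall d g, d \in D -> F g -> F (d * g)%g -> d = 1%g].

Lemma fundamental_domain_inj F d d' g : fundamental_domain F ->
  d \in D -> d' \in D -> F (d * g)%g -> F (d' * g)%g -> d = d'.
Proof.
move=> [_ _ Finj] dD d'D Fd Fd'; apply/esym/eqP; rewrite -divg_eq1; apply/eqP.
apply: (Finj _ (d * g)%g) => //; first exact: gpredF.
by rewrite mulgA mulgVK.
Qed.

Context (V : nat -> set G) (sV : forall n, slice D (V n)).
Hypothesis VT : \bigcup_n V n = setT.

Definition slice_stratum := seqDU (fun n => coset_pi D @` V n).

(** Each coset is represented by its unique point in the first slice that it meets;
    [slice_stratum n] collects the cosets for which this is slice [n]. *)
Definition slice_domain : set G :=
  \bigcup_n (coset_pi D @^-1` slice_stratum n `&` V n).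

Lemma bigcup_slice_stratum : \bigcup_n slice_stratum n = setT.
Proof.
rewrite -seqDU_bigcup_eq -image_bigcup VT.
by apply/seteqP; split => // x _; exists (repr x) => //; exact: coset_pi_repr.
Qed.

Lemma measurable_slice_stratum n :
  measurable (slice_stratum n : set (borel (coset_space D))).
Proof.
have mV k : measurable (coset_pi D @` V k : set (borel (coset_space D))).
  by apply: open_borel; apply: coset_pi_open; case: (sV k).
by apply: measurableD => //; exact: bigsetU_measurable.
Qed.

Lemma coset_pi_preimage_measurable (A : set (borel (coset_space D))) :
  measurable A -> measurable (coset_pi D @^-1` A : set (borel G)).
Proof. by move=> mA; rewrite -[_ @^-1` _]setTI; exact: measurable_coset_pi. Qed.

Lemma slice_domain_inj g h : slice_domain g -> slice_domain h ->
  coset_pi D g = coset_pi D h -> g = h.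
Proof.
move=> [n _ [En Vn]] [m _ [Em Vm]] gh; move: En; rewrite /= gh => En.
have nm : n = m.
  by apply: (@trivIset_seqDU _ (fun n => coset_pi D @` V n)) => //;
    exists (coset_pi D h).
by subst m; exact: (slice_inj (sV n)).
Qed.

Lemma slice_domain_ex x : exists2 g, slice_domain g & coset_pi D g = x.
Proof.
have [n _ En] : (\bigcup_n slice_stratum n) x by rewrite bigcup_slice_stratum.
by have [[g Vg gx] _] := En; exists g => //; exists n => //; split; rewrite //= gx.
Qed.

Lemma slice_domain_fundamental : fundamental_domain slice_domain.
Proof.
split.
- apply: bigcupT_measurable => n; apply: measurableI.
    by apply: coset_pi_preimage_measurable; exact: measurable_slice_stratum.
  by apply: open_borel; case: (sV n).
- move=> g; have [h Fh hg] := slice_domain_ex (coset_pi D g).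
  by exists (h / g)%g; [apply/coset_piP|rewrite mulgVK].
- move=> d g dD Fg Fdg; have := slice_domain_inj Fdg Fg (coset_piM g dD).
  by rewrite -{2}(mul1g g) => /mulIg.
Qed.

(* [repr] is not a Borel map, but the section of [coset_pi D] with values in
   [slice_domain] is one, and an invariant [f] does not distinguish them. *)
Lemma measurable_repr_invariant d (T : measurableType d) (f : G -> T) :
  measurable_fun setT (f : borel G -> T) ->
  (forall d g, d \in D -> f (d * g)%g = f g) ->
  measurable_fun setT (fun x : borel (coset_space D) => f (repr x)).
Proof.
move=> mf fD.
pose s (x : coset_space D) : G := sval (cid2 (slice_domain_ex x)).
have sE x : slice_domain (s x) /\ coset_pi D (s x) = x.
  by rewrite /s; case: cid2.
have ms : measurable_fun setT (s : borel (coset_space D) -> borel G).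
  apply: (@measurability _ _ (borel (coset_space D)) (borel G) setT s (@open G) erefl).
  move=> _ [U oU <-]; rewrite setTI.
  (* On stratum [n] the section inverts the projection of [V n], so the preimage of [U] is there the
     image of an open set. *)
  rewrite (_ : s @^-1` U =
      \bigcup_n (slice_stratum n `&` coset_pi D @` (V n `&` U))).
    apply: bigcupT_measurable => n; apply: measurableI.
      exact: measurable_slice_stratum.
    apply: open_borel; apply: coset_pi_open; apply: openI => //.
    by case: (sV n).
  apply/seteqP; split=> [x /= Usx|x [n _ [Ex [g [Vg Ug] gx]]]]/=.
    have [[n _ [En Vn]] sx] := sE x; exists n => //; rewrite -sx; split => //.
    by exists (s x).
  have [Fsx sx] := sE x; rewrite (slice_domain_inj Fsx _ (etrans sx (esym gx)))//.
  by exists n => //; split; rewrite //= gx.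
rewrite [X in measurable_fun _ X](_ : _ = f \o s); last first.
  apply/funext => x /=; have [_ sx] := sE x.
  by have [e eD] := repr_coset_pi D (s x); rewrite sx => ->; rewrite fD.
exact: (@measurableT_comp _ _ _ (borel (coset_space D)) (borel G) T f setT s).

Qed.

End fundamental_domain.

Section fundamental_domain_integral.
Context (R : realType) (G : topologicalGroupType).
Hypotheses (G_lc : locally_compact [set: G]) (G_T2 : hausdorff_space G).
Hypothesis G_sc : @second_countable G.
Context (mu : {measure set (borel G) -> \bar R}).
Hypotheses (mu_radon : radon mu) (mu_inv : left_invariant mu).
Context (D : groupClosed G) (D_discrete : discrete_subgroup D).

Lemma measurable_mulgl (a : G) (A : set (borel G)) : measurable A ->
  measurable ([set g | A (a * g)%g] : set (borel G)).
Proof.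
move=> mA; rewrite -[[set g | _]]setTI.
have : measurable_fun setT ((fun g => a * g)%g : borel G -> borel G).
  by apply: continuous_borel; exact: mulgl_continuous.
by apply.
Qed.

(** Cut the part of [A] in [F] according to the [d] that moves a point into [F'], and the part in
    [F'] according to the [d] whose inverse moves it into [F]. Left translation by [d] carries one
    piece onto the other, [A] being invariant. *)
Lemma fundamental_domain_measure (F F' A : set (borel G)) :
  fundamental_domain D F -> fundamental_domain D F' -> measurable A ->
  (forall d g, d \in D -> A g -> A (d * g)%g) -> mu (A `&` F) = mu (A `&` F').
Proof.
move=> fF fF' mA AD; have [mF exF _] := fF; have [mF' exF' _] := fF'.
have [e [eD De einj]] := countable_enumerates (discrete_countable G_lc G_sc D_discrete).
pose P n : set (borel G) := if e n is Some d then
  A `&` F `&` [set g | F' (d * g)%g] else set0.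
pose Q n : set (borel G) := if e n is Some d then
  A `&` F' `&` [set g | F (d^-1 * g)%g] else set0.
have PE : A `&` F = \bigcup_n P n.
  apply/seteqP; split=> [g [Ag Fg]|g [n _]]; last first.
    by rewrite /P; case: (e n) => // d [].
  have [d dD F'd] := exF' g; have [n en] := De d dD.
  by exists n => //; rewrite /P en.
have QE : A `&` F' = \bigcup_n Q n.
  apply/seteqP; split=> [g [Ag Fg]|g [n _]]; last first.
    by rewrite /Q; case: (e n) => // d [].
  have [d dD Fd] := exF g; have [|n en] := De d^-1%g; first by rewrite /= gpredV.
  by exists n => //; rewrite /Q en; split => //=; rewrite invgK.
have mP n : measurable (P n).
  rewrite /P; case: (e n) => // d; apply: measurableI; first exact: measurableI.
  exact: measurable_mulgl.
have mQ n : measurable (Q n).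
  rewrite /Q; case: (e n) => // d; apply: measurableI; first exact: measurableI.
  exact: measurable_mulgl.
have tP : trivIset setT P.
  move=> n m _ _ [g []]; rewrite /P.
  case en : (e n) => [d|//]; case em : (e m) => [d'|//] [_ Fd] [_ Fd'].
  apply: (einj _ _ d) => //; rewrite em; congr Some.
  exact: (fundamental_domain_inj fF' (eD _ _ em) (eD _ _ en) Fd' Fd).
have tQ : trivIset setT Q.
  move=> n m _ _ [g []]; rewrite /Q.
  case en : (e n) => [d|//]; case em : (e m) => [d'|//] [_ Fd] [_ Fd'].
  apply: (einj _ _ d) => //; rewrite em; congr Some; apply: invg_inj.
  have d'VD : (d'^-1)%g \in D by rewrite gpredV; exact: eD em.
  have dVD : (d^-1)%g \in D by rewrite gpredV; exact: eD en.
  exact: (fundamental_domain_inj fF d'VD dVD Fd' Fd).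
rewrite PE QE !measure_bigcup//; apply: eq_eseriesr => n _.
rewrite /P /Q; case en : (e n) => [d|//]; have dD := eD _ _ en.
have mAF : measurable (A `&` F `&` [set g | F' (d * g)%g]).
  by have := mP n; rewrite /P en.
rewrite -[LHS](mu_inv d mAF); congr (mu _).
apply/seteqP; split=> [_ [g [[Ag Fg] F'g] <-]|g [[Ag F'g] Fg]].
  by split; [split => //; exact: AD|rewrite /= mulKg].
exists (d^-1 * g)%g; last by rewrite mulVKg.
by split => /=; [split => //; apply: AD; rewrite ?gpredV|rewrite mulVKg].
Qed.

Context (nu : {measure set (borel (coset_space D)) -> \bar R}).
Hypothesis nuP : quotient_measure mu nu.

(** Since [F] may be exchanged for [slice_domain], the measure can be added up over the strata, each
    of which lies under a single slice. *)
Lemma quotient_measureE (F : set (borel G)) (A : set (borel (coset_space D))) :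
  fundamental_domain D F -> measurable A -> nu A = mu (coset_pi D @^-1` A `&` F).
Proof.
move=> fF mA; have [V [sV VL VT]] := exists_slices G_lc G_sc D_discrete.
rewrite (fundamental_domain_measure fF (slice_domain_fundamental sV VT)).
- rewrite /slice_domain setI_bigcupr measure_bigcup; last 2 first.
  + move=> n _; apply: measurableI; first exact: coset_pi_preimage_measurable.
    apply: measurableI; last by apply: open_borel; case: (sV n).
    by apply: coset_pi_preimage_measurable; exact: measurable_slice_stratum.
  + move=> n m _ _ [g [[_ [En _]] [_ [Em _]]]].
    by apply: (@trivIset_seqDU _ (fun n => coset_pi D @` V n)) => //;
      exists (coset_pi D g).
  rewrite -[A in LHS]setIT -(bigcup_slice_stratum D VT) setI_bigcupr measure_bigcup.
  + apply: eq_eseriesr => n _; have [L cL VnL] := VL n.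
    have mAE : measurable (A `&` slice_stratum V n : set (borel (coset_space D))).
      by apply: measurableI => //; exact: measurable_slice_stratum.
    have := slice_measure G_lc G_T2 mu_radon nuP (sV n) cL VnL mAE.
    rewrite (@setIidl _ (_ `&` _)); last by move=> x [_ []].
    by move=> ->; congr (mu _); apply/esym; exact: setIA.
  + by move=> n _; apply: measurableI => //; exact: measurable_slice_stratum.
  + move=> n m _ _ [x [[_ En] [_ Em]]].
    by apply: (@trivIset_seqDU _ (fun n => coset_pi D @` V n)) => //; exists x.
- exact: coset_pi_preimage_measurable.
- by move=> d g dD /=; rewrite coset_piM.
Qed.

Lemma measurable_repr d (T : measurableType d) (f : G -> T) :
  measurable_fun setT (f : borel G -> T) ->
  (forall d g, d \in D -> f (d * g)%g = f g) ->
  measurable_fun setT (fun x : borel (coset_space D) => f (repr x)).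
Proof.
have [V [sV _ VT]] := exists_slices G_lc G_sc D_discrete.
exact: (measurable_repr_invariant sV VT).
Qed.

Lemma quotient_integralE (F : set (borel G)) (f : G -> \bar R) :
  fundamental_domain D F ->
  measurable_fun setT (f : borel G -> \bar R) ->
  (forall d g, d \in D -> f (d * g)%g = f g) -> (forall g, 0 <= f g)%E ->
  (\int[nu]_x f (repr x) = \int[mu]_(g in F) f g)%E.
Proof.
move=> fF mf fD f0; have [mF _ _] := fF.
rewrite (@integral_image_measure _ _ (borel G) (borel (coset_space D)) _
  (coset_pi D) F mu nu (f \o repr))//.
- apply: eq_integral => g _ /=.
  by have [d dD ->] := repr_coset_pi D g; rewrite fD.
- exact: measurable_coset_pi.
- by move=> A mA; exact: quotient_measureE.
- exact: measurable_repr.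
- by move=> y; exact: f0.
Qed.

End fundamental_domain_integral.

(** * Unfolding *)

Section unfolding.
Context (R : realType) (G : topologicalGroupType).
Hypotheses (G_lc : locally_compact [set: G]) (G_T2 : hausdorff_space G).
Hypothesis G_sc : @second_countable G.
Context (mu : {measure set (borel G) -> \bar R}).
Hypotheses (mu_radon : radon mu) (mu_inv : left_invariant mu).

Lemma integral_mulgl (a : G) (F : set (borel G)) (f : G -> \bar R) :
  measurable F -> measurable_fun setT (f : borel G -> \bar R) ->
  (forall g, 0 <= f g)%E ->
  (\int[mu]_(g in [set g | F (a^-1 * g)%g]) f g =
   \int[mu]_(g in F) f (a * g)%g)%E.
Proof.
move=> mF mf f0; set aF := [set g | _].
have maF : measurable (aF : set (borel G)) by exact: measurable_mulgl.
rewrite integral_mkcond [RHS]integral_mkcond.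
rewrite (@integral_image_measure _ _ (borel G) (borel G) _
  (fun g => (a * g)%g) setT mu mu).
- apply: eq_integral => g _; rewrite !patchE; congr (if _ then _ else _).
  by rewrite /aF; apply/idP/idP; rewrite !inE /= mulKg.
- by apply: continuous_borel; exact: mulgl_continuous.
- exact: measurableT.
- move=> A mA; rewrite setIT -(mu_inv (a^-1)%g mA) image_mulgl.
  by congr (mu _); apply/seteqP; split => g; rewrite /= invgK.
- apply: (proj1 (measurable_restrictT _ maF)).
  exact: (@measurable_funTS _ _ (borel G) _ aF f).
- by move=> g; rewrite patchE; case: ifP.
Qed.

Context (Gamma Lambda : groupClosed G) (Lambda_sub : {subset Lambda <= Gamma}).
Context (e : nat -> option (coset_space Lambda)).
Hypothesis eP : enumerates (coset_pi Lambda @` [set` Gamma]) e.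

Lemma repr_coset_mem (x : coset_space Lambda) :
  (coset_pi Lambda @` [set` Gamma]) x -> repr x \in Gamma.
Proof.
move=> [g gG <-]; have [l lL ->] := repr_coset_pi Lambda g.
by apply: gpredM => //; exact: Lambda_sub.
Qed.

Lemma enumerates_mem n x : e n = Some x -> repr x \in Gamma.
Proof. by case: eP => eS _ _ /eS; exact: repr_coset_mem. Qed.

Section translates.
Context (F : set (borel G)) (fF : fundamental_domain Gamma F).

(** This is the translate of [F] by [repr x], written as a preimage. *)
Definition coset_translate n : set (borel G) :=
  if e n is Some x then [set g | F ((repr x)^-1 * g)%g] else set0.

Lemma measurable_coset_translate n : measurable (coset_translate n).
Proof.
rewrite /coset_translate; case: (e n) => [x|]; last exact: measurable0.
by apply: measurable_mulgl; case: fF.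
Qed.

(** Write x, y for the representatives. Both the inverse of x and the inverse of y times [l] move
    [g] into [F], so y = l x. Hence the cosets agree, and then [l] is 1. The case of general [l]
    serves the fundamental domain of [Lambda], the case [l = 1] disjointness of the translates. *)
Lemma coset_translate_eq n m x y g l : l \in Lambda ->
  e n = Some x -> e m = Some y -> F ((repr x)^-1 * g)%g ->
  F ((repr y)^-1 * (l * g))%g -> n = m /\ l = 1%g.
Proof.
move=> lL en em Fx; rewrite mulgA => Fy.
have xG : (repr x)^-1%g \in Gamma by rewrite gpredV; exact: enumerates_mem en.
have yG : ((repr y)^-1 * l)%g \in Gamma.
  apply: gpredM; last exact: Lambda_sub.
  by rewrite gpredV; exact: enumerates_mem em.
have /(congr1 (fun g => repr y * g * repr x)%g) :=
  fundamental_domain_inj fF xG yG Fx Fy.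
rewrite mulVKg mulgVK => yx.
have xy : x = y.
  rewrite -(coset_pi_repr x) -(coset_pi_repr y); apply/esym/coset_piP.
  by rewrite yx mulgK.
subst y; split; first by case: eP => _ _; apply; [exact: en|exact: em].
by move: yx; rewrite -{1}(mul1g (repr x)) => /mulIg.
Qed.

Lemma fundamental_domain_translates :
  fundamental_domain Lambda (\bigcup_n coset_translate n).
Proof.
have [mF exF _] := fF; split.
- by apply: bigcupT_measurable => n; exact: measurable_coset_translate.
- move=> g; have [d dG Fd] := exF g.
  (* The coset of the inverse of [d] is the right one: its representative is x = l / d, and the
     inverse of x sends [l g] to [d g], which lies in [F]. *)
  have [l lL dx] := repr_coset_pi Lambda (d^-1)%g.
  have [_ eex _] := eP.
  have [|n en] := eex (coset_pi Lambda (d^-1)%g).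
    by exists (d^-1)%g => //=; rewrite gpredV.
  exists l => //; exists n => //; rewrite /coset_translate en /= dx.
  by rewrite invgM invgK mulgA mulgVK.
- move=> l g lL [n _] + [m _]; rewrite /coset_translate.
  case en : (e n) => [x|//]; case em : (e m) => [y|//] Fx Fy.
  by have [] := coset_translate_eq lL en em Fx Fy.
Qed.

Lemma trivIset_coset_translate : trivIset setT coset_translate.
Proof.
move=> n m _ _ [g []]; rewrite /coset_translate.
case en : (e n) => [x|//]; case em : (e m) => [y|//] /= Fx Fy.
rewrite -(mul1g g) in Fy.
by have [] := coset_translate_eq (gpred1 : 1%g \in Lambda) en em Fx Fy.
Qed.

End translates.

Hypothesis Gamma_discrete : discrete_subgroup Gamma.
Context (nu : {measure set (borel (coset_space Lambda)) -> \bar R}).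
Hypothesis nuP : quotient_measure mu nu.

Lemma unfolding (F : set (borel G)) (f : G -> \bar R) :
  fundamental_domain Gamma F ->
  measurable_fun setT (f : borel G -> \bar R) ->
  (forall l g, l \in Lambda -> f (l * g)%g = f g) -> (forall g, 0 <= f g)%E ->
  (\int[nu]_x f (repr x) = \int[mu]_(g in F)
     \sum_(0 <= n <oo) (if e n is Some x then f (repr x * g)%g else 0))%E.
Proof.
move=> fF mf fL f0; have [mF _ _] := fF.
have fd := fundamental_domain_translates fF.
rewrite (quotient_integralE G_lc G_T2 G_sc mu_radon mu_inv
  (discrete_subset Lambda_sub Gamma_discrete) nuP fd)//.
rewrite ge0_integral_bigcup//; first last.
- exact: trivIset_coset_translate.
- exact: measurable_funTS.
- by move=> n; exact: measurable_coset_translate.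
rewrite integral_nneseries//.
- apply: eq_eseriesr => n _; rewrite /coset_translate.
  case: (e n) => [x|]; first exact: integral_mulgl.
  by rewrite integral_set0 integral0.
- move=> n; case: (e n) => [x|]; last exact: measurable_cst.
  apply: measurable_funTS; apply: (@measurableT_comp _ _ _ (borel G) (borel G)) => //.
  by apply: continuous_borel; exact: mulgl_continuous.
- by move=> n g _; case: (e n).
Qed.

End unfolding.

(** * Absolutely convergent complex series *)

Section enumeration.
Context (R : realType) (T : pointedType) (S : set T) (e : nat -> option T).
Hypothesis eP : enumerates S e.

(** The right side does not mention [e], so nonnegative sums along two enumerations of [S] agree. *)
Lemma enumerates_esum (f : T -> \bar R) : (forall x, 0 <= f x)%E ->
  (\sum_(0 <= n <oo) (if e n is Some x then f x else 0) =
   \esum_(x in S) f x)%E.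
Proof.
move=> f0; have [eS Se einj] := eP.
pose P := [set n | isSome (e n)]; pose g n := odflt point (e n).
have ginj : set_inj P g.
  move=> n m; rewrite !inE /P /g /=.
  case en : (e n) => [x|//]; case em : (e m) => [y|//] _ _ /= xy; subst y.
  exact: einj en em.
have gP : S = g @` P.
  apply/seteqP; split=> [x /Se[n en]|_ [n + <-]].
    by exists n; rewrite /P /g /= en.
  by rewrite /P /g /=; case en : (e n) => [x|//] _ /=; exact: eS en.
rewrite gP esum_set_image// [RHS]eseries_mkcond; apply: eq_eseriesr => n _.
rewrite /P /g; case: ifPn; first by rewrite inE /=; case: (e n).
by rewrite notin_setE /=; case: (e n) => // x [].
Qed.

(** Right translation by an element of [Gamma] permutes the cosets and so re-enumerates them. *)
Lemma enumerates_bij (s : T -> T) : set_bij S S s ->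
  enumerates S (fun n => omap s (e n)).
Proof.
move=> [sS sinj ssurj]; have [eS Se einj] := eP; split.
- by move=> n x; case en : (e n) => [y|//] /= [<-]; apply: sS; exact: eS en.
- move=> x /ssurj[y Sy <-]; have [n en] := Se y Sy.
  by exists n; rewrite en.
- move=> n m x; case en : (e n) => [y|//]; case em : (e m) => [z|//] /= [sy] [sz].
  apply: (einj _ _ y) => //; rewrite em; congr Some; apply: sinj.
  + by rewrite inE; exact: eS em.
  + by rewrite inE; exact: eS en.
  + by rewrite sy sz.
Qed.

End enumeration.

Section complex_series.
Context {R : realType}.
Local Notation normc := Normc.normc.
Implicit Types z : nat -> R[i]^o.

Lemma normr_normc (x : R[i]) : `|x| = (normc x)%:C%C.
Proof. by []. Qed.

Lemma normc_ge0 (x : R[i]) : 0 <= normc x.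
Proof. by case: x => a b; exact: sqrtr_ge0. Qed.

Lemma Re_le_normc (x : R[i]) : `|complex.Re x| <= normc x.
Proof.
case: x => a b /=; rewrite -sqrtr_sqr ler_wsqrtr// lerDl; exact: sqr_ge0.
Qed.

Lemma Im_le_normc (x : R[i]) : `|complex.Im x| <= normc x.
Proof.
case: x => a b /=; rewrite -sqrtr_sqr ler_wsqrtr// lerDr; exact: sqr_ge0.
Qed.

Lemma normc_le_Re_Im (x : R[i]) :
  normc x <= `|complex.Re x| + `|complex.Im x|.
Proof.
case: x => a b /=; rewrite -[leRHS]ger0_norm ?addr_ge0// -sqrtr_sqr.
rewrite ler_wsqrtr// sqrrD !real_normK ?num_real// addrAC lerDl.
by rewrite mulrn_wge0 ?mulr_ge0.
Qed.

Lemma cvg_normcP {T : Type} (F : set_system T) {FF : Filter F}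
    (f : T -> R[i]^o) (l : R[i]^o) :
  (forall eps : R, 0 < eps -> \forall x \near F, normc (l - f x) < eps) ->
  f @ F --> l.
Proof.
(* A positive element of [R[i]] has imaginary part 0, so only real radii occur. *)
move=> h; apply/cvgrPdist_lt => -[a b]; rewrite ltcE /= => /andP[/eqP -> a0].
by apply: filterS (h a a0) => x; rewrite normr_normc ltcR.
Qed.

Lemma normc_sum (I : Type) (r : seq I) (P : pred I) (f : I -> R[i]) :
  normc (\sum_(i <- r | P i) f i) <= \sum_(i <- r | P i) normc (f i).
Proof.
elim/big_ind2 : _ => // [|x a y b xa yb]; first by rewrite Normc.normc0.
by apply: le_trans (le_normcD _ _) _; exact: lerD.
Qed.

(** The real and imaginary parts are real series dominated by the series of moduli. *)
Lemma cvg_normc_series z : (\sum_(0 <= n <oo) (normc (z n))%:E < +oo)%E ->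
  cvgn (series z).
Proof.
move=> zoo; have cz := nnseries_is_cvg (fun n => normc_ge0 (z n)) zoo.
have cvg_part (p : R[i] -> R) : p 0 = 0 -> {morph p : x y / x + y} ->
    (forall x, `|p x| <= normc x) -> cvgn (fun n => p (series z n)).
  move=> p0 pD pz.
  rewrite (_ : (fun _ => _) = series (fun n => p (z n))); last first.
    by apply/funext => n; rewrite /series /= (big_morph p pD p0).
  apply: normed_cvg; apply: series_le_cvg cz => n.
  - exact: normr_ge0.
  - exact: normc_ge0.
  - exact: pz.
have ReD : {morph @complex.Re R : x y / x + y} by move=> [? ?] [? ?].
have ImD : {morph @complex.Im R : x y / x + y} by move=> [? ?] [? ?].
have /cvg_ex[/= a ca] := cvg_part _ erefl ReD Re_le_normc.
have /cvg_ex[/= b cb] := cvg_part _ erefl ImD Im_le_normc.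
apply/cvg_ex; exists (a +i* b)%C; apply: cvg_normcP => eps eps0.
have eps2 : 0 < eps / 2 by rewrite divr_gt0.
near=> n; rewrite (splitr eps).
have na : `|a - complex.Re (series z n)| < eps / 2.
  by near: n; move/cvgrPdist_lt : ca; exact.
have nb : `|b - complex.Im (series z n)| < eps / 2.
  by near: n; move/cvgrPdist_lt : cb; exact.
apply: le_lt_trans (normc_le_Re_Im _) _.
by case: (series z n) na nb => u v /= na nb; exact: ltrD.
Unshelve. all: by end_near. Qed.

Lemma normc_dist_lim z : cvgn (series z) -> forall eps : R, 0 < eps ->
  \forall n \near \oo, normc (limn (series z) - series z n) < eps.
Proof.
move=> /cvgrPdist_lt cz eps eps0; have := cz eps%:C%C; rewrite ltcR => /(_ eps0).
by apply: filterS => n; rewrite normr_normc ltcR.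
Qed.

Section summation.
Context (T : pointedType) (S : set T) (e : nat -> option T).
Hypothesis eP : enumerates S e.

Lemma big_enumerates (a : T -> R[i]^o) (r : seq T) : uniq r ->
  (forall x, ~ S x -> a x = 0) ->
  \forall M \near \oo, \sum_(x <- r) a x =
    \sum_(0 <= n < M) (if e n is Some x then if x \in r then a x else 0 else 0).
Proof.
move=> + a0; have [_ Se einj] := eP; elim: r => [_|x r IH /= /andP[xr ur]].
  by near=> M; rewrite big_nil big1_seq// => n _; case: (e n).
have xE : \forall M \near \oo, a x =
    \sum_(0 <= n < M) (if e n is Some y then if y == x then a y else 0 else 0).
  have [Sx|nSx] := pselect (S x).
    have [k ek] := Se _ Sx; near=> M.
    have kM : k \in index_iota 0 M by rewrite mem_index_iota; near: M; exists k.+1.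
    rewrite (bigD1_seq k)//= ?iota_uniq// ek eqxx big1 ?addr0// => n nk.
    case en : (e n) => [y|//]; case: eqP => // yx; subst y.
    by move/eqP: nk; case; exact: einj en ek.
  near=> M; rewrite (a0 x nSx) big1// => n _.
  by case: (e n) => // y; case: eqP => // ->; exact: a0.
near=> M; rewrite big_cons.
have -> : \sum_(x <- r) a x = \sum_(0 <= n < M)
    (if e n is Some x then if x \in r then a x else 0 else 0).
  by near: M; exact: IH.
have -> : a x = \sum_(0 <= n < M)
    (if e n is Some y then if y == x then a y else 0 else 0) by near: M.
rewrite -big_split/=; apply: eq_bigr => n _; case: (e n) => [y|]; last by rewrite addr0.
rewrite inE; case: eqP => [->|_] /=; last by rewrite add0r.
by rewrite (negbTE xr) addr0.
Unshelve. all: by end_near. Qed.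

(** A finite index set that contains the first [N] enumerated indices contributes [series z N] and
    further terms of index at least [N], which the tail of the series of moduli controls. *)
Lemma sum_enumerates (a : T -> R[i]^o) : (forall x, ~ S x -> a x = 0) ->
  let z n : R[i]^o := if e n is Some x then a x else 0 in
  (\sum_(0 <= n <oo) (normc (z n))%:E < +oo)%E ->
  summability.sum a = limn (series z).
Proof.
move=> a0 z zoo; rewrite /summability.sum.
have Ftot := @summability.totally_filter T.
apply: (cvg_lim (@norm_hausdorff _ _)).
apply: cvg_normcP => eps eps0.
have eps2 : 0 < eps / 2 by rewrite divr_gt0.
have cu := nnseries_is_cvg (fun n => normc_ge0 (z n)) zoo.
have ndu : nondecreasing_seq (series (fun n => normc (z n))).
  by apply: nondecreasing_series => n _ _; exact: normc_ge0.
have [N [zN uN]] : exists N, normc (limn (series z) - series z N) < eps / 2 /\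
    limn (series (fun n => normc (z n))) - series (fun n => normc (z n)) N < eps / 2.
  near \oo => N; exists N; split.
    by near: N; apply: normc_dist_lim => //; exact: cvg_normc_series.
  apply: le_lt_trans (ler_norm _) _.
  by near: N; move/cvgrPdist_lt : cu; exact.
(* [B] holds the indices enumerated before stage [N]. *)
have [B BE] : exists B : {fset T}, B =i pmap e (iota 0 N).
  by exists (seq_fset tt (pmap e (iota 0 N))); exact: seq_fsetE.
exists B => //= A BA.
have [M [NM AM]] : exists M, (N <= M)%N /\ \sum_(x <- A) a x = \sum_(0 <= n < M)
    (if e n is Some x then if x \in A then a x else 0 else 0).
  near \oo => M; exists M; split; first by near: M; exists N.
  by near: M; apply: big_enumerates => //; exact: fset_uniq.
rewrite /summability.partial_sum -(big_seq_fsetE _ _ xpredT a) AM.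
rewrite (big_cat_nat (leq0n N) NM)//=.
rewrite [X in _ - (X + _)](_ : _ = series z N); last first.
  rewrite /series /=; apply: eq_big_nat => n /= nN; rewrite /z; case en : (e n) => [x|//].
  rewrite (fsubsetP BA)// BE mem_pmap; apply/mapP; exists n => //.
  by rewrite mem_iota add0n.
rewrite opprD addrA; apply: le_lt_trans (le_normcD _ _) _.
rewrite (splitr eps) ltrD// normcN; apply: le_lt_trans (normc_sum _ _ _) _.
apply: le_lt_trans uN.
apply: (@le_trans _ _ (\sum_(N <= n < M) normc (z n))).
  apply: ler_sum => n _; rewrite /z; case: (e n) => [x|//].
  by case: ifP => // _; rewrite Normc.normc0 normc_ge0.
by rewrite lerBrDl /series /= -big_cat_nat//; exact: nondecreasing_cvgn_le.
Unshelve. all: by end_near. Qed.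

End summation.

End complex_series.

(** * The Poincare series *)

Section poincare.
Context (R : realType) (G : topologicalGroupType).
Context (Gamma Lambda : groupClosed G) (Lambda_sub : {subset Lambda <= Gamma}).
Context (chi phi : G -> R[i]) (chi_unitary : unitary_character Gamma chi).
Hypothesis F1 : forall l g, l \in Lambda -> phi (l * g)%g = chi l * phi g.
Context (e : nat -> option (coset_space Lambda)).
Hypothesis eP : enumerates (coset_pi Lambda @` [set` Gamma]) e.
Local Notation normc := Normc.normc.

Definition poincare_term (g : G) (x : coset_space Lambda) : R[i]^o :=
  (chi (repr x))^*%C * phi (repr x * g)%g.

(** The enumeration is an explicit argument, shadowing the section variable, because translation by
    [Gamma] changes it. *)
Definition poincare_seq (e : nat -> option (coset_space Lambda)) (g : G)
    (n : nat) : R[i]^o :=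
  if e n is Some x then poincare_term g x else 0.

Lemma normr_poincare_term g x : repr x \in Gamma ->
  `|poincare_term g x| = `|phi (repr x * g)%g|.
Proof.
have [_ chi1] := chi_unitary => xG.
by rewrite normrM normcJ chi1// mul1r.
Qed.

Lemma normc_poincare_term g x : repr x \in Gamma ->
  normc (poincare_term g x) = normc (phi (repr x * g)%g).
Proof. by move=> /(normr_poincare_term g) /(congr1 (@complex.Re R)). Qed.

Definition abs_poincare (g : G) : \bar R :=
  (\sum_(0 <= n <oo)
     (if e n is Some x then (normc (phi (repr x * g)%g))%:E else 0))%E.

Lemma abs_poincareE e' g : enumerates (coset_pi Lambda @` [set` Gamma]) e' ->
  (\sum_(0 <= n <oo) (normc (poincare_seq e' g n))%:E = abs_poincare g)%E.
Proof.
move=> e'P; rewrite /abs_poincare.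
pose f (x : coset_space Lambda) : \bar R := (normc (phi (repr x * g)%g))%:E.
have f0 x : (0 <= f x)%E by rewrite lee_fin normc_ge0.
rewrite (enumerates_esum eP f0) -(enumerates_esum e'P f0).
apply: eq_eseriesr => n _; rewrite /poincare_seq.
case en : (e' n) => [x|]; last by rewrite Normc.normc0.
by rewrite normc_poincare_term//; exact: (enumerates_mem Lambda_sub e'P en).
Qed.

Lemma poincare_seriesE e' g : enumerates (coset_pi Lambda @` [set` Gamma]) e' ->
  (abs_poincare g < +oo)%E ->
  poincare_series Lambda Gamma chi phi g = limn (series (poincare_seq e' g)).
Proof.
move=> e'P; rewrite -(abs_poincareE _ e'P) => goo.
set S := coset_pi Lambda @` [set` Gamma].
pose a : coset_space Lambda -> R[i]^o := (poincare_term g) \_ S.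
have zE : (fun n => if e' n is Some x then a x else 0) = poincare_seq e' g.
  apply/funext => n; rewrite /poincare_seq; case en : (e' n) => [x|//].
  by rewrite /a patchE mem_set//; case: e'P => + _ _; apply; exact: en.
have aS x : ~ S x -> a x = 0 by move=> nSx; rewrite /a patchE memNset.
by move: goo; rewrite -zE; exact: (sum_enumerates e'P aS).
Qed.

(** Right multiplication by [c] on cosets: the term of the series at [c g] for a coset is, up to
    [chi c], the term at [g] for its image. *)
Definition coset_act (c : G) (x : coset_space Lambda) : coset_space Lambda :=
  coset_pi Lambda (repr x * c)%g.

Lemma coset_act_bij c : c \in Gamma ->
  set_bij (coset_pi Lambda @` [set` Gamma]) (coset_pi Lambda @` [set` Gamma])
    (coset_act c).
Proof.
move=> cG; split.
- move=> x Sx; exists (repr x * c)%g => //=.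
  by rewrite gpredM// repr_coset_mem.
- move=> x y _ _ /coset_piP; rewrite mulgKA => /coset_piP.
  by rewrite !coset_pi_repr.
- move=> y Sy; exists (coset_pi Lambda (repr y / c)%g).
    by exists (repr y / c)%g => //=; rewrite gpredF// repr_coset_mem.
  rewrite /coset_act; have [l lL ->] := repr_coset_pi Lambda (repr y / c)%g.
  by rewrite -mulgA mulgVK coset_piM// coset_pi_repr.
Qed.

Lemma poincare_term_act c g x : c \in Gamma -> repr x \in Gamma ->
  poincare_term (c * g)%g x = chi c * poincare_term g (coset_act c x).
Proof.
have [chiM chi1] := chi_unitary => cG xG; rewrite /poincare_term /coset_act.
have [l lL ->] := repr_coset_pi Lambda (repr x * c)%g.
have lG := Lambda_sub lL.
have chiJ d : d \in Gamma -> chi d * (chi d)^*%C = 1.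
  by move=> dG; rewrite -sqr_normc chi1// expr1n.
have xcG : (repr x * c)%g \in Gamma by exact: gpredM.
rewrite (chiM _ _ lG xcG) (chiM _ _ xG cG) !rmorphM/= -!mulgA (F1 _ lL).
(* The representative of the translated coset is [l * repr x * c]; (F1) produces the factor [chi l],
   which cancels against its conjugate. *)
transitivity ((chi c * (chi c)^*%C) * (chi l * (chi l)^*%C) *
  ((chi (repr x))^*%C * phi (repr x * (c * g))%g)).
  by rewrite !chiJ// !mul1r.
by ring.
Qed.

Lemma poincare_seq_act c g n : c \in Gamma ->
  poincare_seq e (c * g)%g n =
  chi c * poincare_seq (fun n => omap (coset_act c) (e n)) g n.
Proof.
move=> cG; rewrite /poincare_seq; case en : (e n) => [x|] /=.
  by apply: poincare_term_act => //; exact: (enumerates_mem Lambda_sub eP en).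
by rewrite mulr0.
Qed.

Lemma abs_poincare_act c g : c \in Gamma ->
  abs_poincare (c * g)%g = abs_poincare g.
Proof.
move=> cG; rewrite -(abs_poincareE _ eP).
rewrite -(abs_poincareE g (enumerates_bij eP (coset_act_bij cG))).
apply: eq_eseriesr => n _; rewrite poincare_seq_act// Normc.normcM.
have [_ chi1] := chi_unitary.
by have /(congr1 (@complex.Re R)) /= -> := chi1 _ cG; rewrite mul1r.
Qed.

(** Absolute convergence lets the series at [g] be summed along the permuted enumeration. It then
    differs from the series at [c g] by the factor [chi c] of modulus 1. *)
Lemma normc_poincare_act c g : c \in Gamma -> (abs_poincare g < +oo)%E ->
  normc (poincare_series Lambda Gamma chi phi (c * g)%g) =
  normc (poincare_series Lambda Gamma chi phi g).
Proof.
move=> cG goo; have e'P := enumerates_bij eP (coset_act_bij cG).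
rewrite (poincare_seriesE eP); last by rewrite abs_poincare_act.
rewrite (poincare_seriesE e'P goo); set e' := fun n => _.
have -> : series (poincare_seq e (c * g)%g) =
    (fun n => chi c *: series (poincare_seq e' g) n).
  apply/funext => n; rewrite /series /= scaler_sumr.
  by apply: eq_bigr => k _; rewrite poincare_seq_act.
rewrite limZr; last first.
  by apply: cvg_normc_series; rewrite (abs_poincareE _ e'P).
rewrite Normc.normcM; have [_ chi1] := chi_unitary.
by have /(congr1 (@complex.Re R)) /= -> := chi1 _ cG; rewrite mul1r.
Qed.

End poincare.

(** * Measurability of the modulus of the Poincare series *)

Section poincare_measurable.
Context (R : realType) (G : topologicalGroupType).
Context (Gamma Lambda : groupClosed G) (Lambda_sub : {subset Lambda <= Gamma}).
Context (chi phi : G -> R[i]) (chi_unitary : unitary_character Gamma chi).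
Context (e : nat -> option (coset_space Lambda)).
Hypothesis eP : enumerates (coset_pi Lambda @` [set` Gamma]) e.
Hypothesis phi_meas :
  measurable_fun [set: borel G] (phi : borel G -> borel R[i]^o).
Local Notation normc := Normc.normc.

Lemma normc_lipschitz_continuous (p : R[i]^o -> R) :
  (forall x y : R[i], `|p x - p y| <= normc (x - y)) -> continuous p.
Proof.
move=> pl x; apply/(@cvgrPdist_lt _ _ _ (nbhs (x : R[i]^o)) (nbhs_filter _)) => eps eps0.
have eps0' : 0 < eps%:C%C :> R[i] by rewrite ltcR.
apply: filterS (nbhsx_ballx (x : R[i]^o) _ eps0') => y.
rewrite -ball_normE /= normr_normc ltcR; exact: le_lt_trans.
Qed.

Lemma Re_continuous : continuous (@complex.Re R : R[i]^o -> R).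
Proof.
apply: normc_lipschitz_continuous => x y; apply: le_trans (Re_le_normc _).
by case: x y => [a b] [c d].
Qed.

Lemma Im_continuous : continuous (@complex.Im R : R[i]^o -> R).
Proof.
apply: normc_lipschitz_continuous => x y; apply: le_trans (Im_le_normc _).
by case: x y => [a b] [c d].
Qed.

Lemma normc_continuous : continuous (@Normc.normc R : R[i]^o -> R).
Proof.
apply: normc_lipschitz_continuous => x y.
rewrite ler_norml; apply/andP; split.
  rewrite lerNl opprB lerBlDr (_ : normc (x - y) = normc (y - x)).
    by rewrite -{1}(subrK x y); exact: le_normcD.
  by rewrite -[RHS]normcN opprB.
by rewrite lerBlDr -{1}(subrK y x); exact: le_normcD.
Qed.

Lemma measurable_translate d (T : measurableType d) (f : borel G -> T) (a : G) :
  measurable_fun setT f -> measurable_fun setT (fun g : borel G => f (a * g)%g).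
Proof.
move=> mf; apply: (@measurableT_comp _ _ _ (borel G) (borel G) T f setT
  (fun g => a * g)%g mf).
by apply: continuous_borel; exact: mulgl_continuous.
Qed.

Lemma measurable_normc_phi :
  measurable_fun setT ((fun g => normc (phi g)) : borel G -> R).
Proof.
apply: (@measurableT_comp _ _ _ (borel G) (borel R[i]^o) R (@Normc.normc R)) => //.
by apply: continuous_borel_real; exact: normc_continuous.
Qed.

Lemma measurable_abs_poincare :
  measurable_fun setT (abs_poincare phi e : borel G -> \bar R).
Proof.
rewrite (_ : abs_poincare phi e = fun g : borel G => (\sum_(0 <= n <oo | n \in xpredT)
    (if e n is Some x then (normc (phi (repr x * g)%g))%:E else 0))%E); last first.
  by apply/funext => g; apply: eq_eseriesl => n.
apply: ge0_emeasurable_sum => n.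
  by move=> g _ _; case: (e n) => // x; rewrite lee_fin normc_ge0.
move=> _; case: (e n) => [x|]; last exact: measurable_cst.
apply/measurable_EFinP.
exact: (measurable_translate (repr x) measurable_normc_phi).
Qed.

Definition complex_measurable (f : G -> R[i]) :=
  measurable_fun setT ((fun g => complex.Re (f g)) : borel G -> R) /\
  measurable_fun setT ((fun g => complex.Im (f g)) : borel G -> R).

Lemma complex_measurable_normc f : complex_measurable f ->
  measurable_fun setT ((fun g => normc (f g)) : borel G -> R).
Proof.
move=> [mr mi].
rewrite (_ : (fun g => _) = (fun g : borel G =>
  Num.sqrt (complex.Re (f g) ^+ 2 + complex.Im (f g) ^+ 2))); last first.
  by apply/funext => g; case: (f g).
apply: (@measurableT_comp _ _ _ (borel G) R R Num.sqrt).
  by apply: continuous_measurable_fun; exact: sqrt_continuous.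
by apply: measurable_funD; apply: measurable_funX.
Qed.

Lemma complex_measurable_sum (f : nat -> G -> R[i]) n :
  (forall k, complex_measurable (f k)) ->
  complex_measurable (fun g => \sum_(0 <= k < n) f k g).
Proof.
have ReD : {morph @complex.Re R : x y / x + y} by move=> [? ?] [? ?].
have ImD : {morph @complex.Im R : x y / x + y} by move=> [? ?] [? ?].
move=> mf; split.
- under eq_fun do rewrite (big_morph _ ReD (erefl : @complex.Re R 0 = 0)).
  by apply: measurable_sum => k; case: (mf k).
- under eq_fun do rewrite (big_morph _ ImD (erefl : @complex.Im R 0 = 0)).
  by apply: measurable_sum => k; case: (mf k).
Qed.

Lemma complex_measurableM (c : R[i]) f : complex_measurable f ->
  complex_measurable (fun g => c * f g).
Proof.
case: c => a b [mr mi]; split.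
- rewrite (_ : (fun g => _) = (fun g : borel G =>
    a * complex.Re (f g) - b * complex.Im (f g))); last first.
    by apply/funext => g; case: (f g).
  by apply: measurable_funB; apply: measurable_funM.
- rewrite (_ : (fun g => _) = (fun g : borel G =>
    a * complex.Im (f g) + b * complex.Re (f g))); last first.
    by apply/funext => g; case: (f g).
  by apply: measurable_funD; apply: measurable_funM.
Qed.

Lemma complex_measurable_poincare_seq n :
  complex_measurable (fun g => poincare_seq chi phi e g n).
Proof.
rewrite /poincare_seq; case: (e n) => [x|]; last first.
  by split; exact: measurable_cst.
apply: complex_measurableM; split.
  apply: (@measurable_translate _ _ (fun g => complex.Re (phi g)) (repr x)).
  apply: (@measurableT_comp _ _ _ (borel G) (borel R[i]^o) R (@complex.Re R)) => //.
  by apply: continuous_borel_real; exact: Re_continuous.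
apply: (@measurable_translate _ _ (fun g => complex.Im (phi g)) (repr x)).
apply: (@measurableT_comp _ _ _ (borel G) (borel R[i]^o) R (@complex.Im R)) => //.
by apply: continuous_borel_real; exact: Im_continuous.
Qed.

Lemma measurable_abs_poincare_lty :
  measurable ([set g | (abs_poincare phi e g < +oo)%E] : set (borel G)).
Proof.
rewrite -[[set g | _]]setTI.
exact: (emeasurable_fun_infty_o measurableT measurable_abs_poincare).
Qed.

(* [|P phi|] cut down to the set of absolute convergence, where the series along
   [e] computes it; this makes it measurable. *)
Definition poincare_norm (g : G) : R :=
  if (abs_poincare phi e g < +oo)%E
  then normc (poincare_series Lambda Gamma chi phi g) else 0.

Lemma measurable_poincare_norm :
  measurable_fun setT (poincare_norm : borel G -> R).
Proof.
pose N : set (borel G) := [set g | (abs_poincare phi e g < +oo)%E].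
rewrite (_ : poincare_norm =
    (fun g => normc (poincare_series Lambda Gamma chi phi g)) \_ N); last first.
  apply/funext => g; rewrite patchE /poincare_norm; case: ifPn => gN.
    by rewrite mem_set.
  by rewrite memNset//; exact/negP.
apply: (proj1 (measurable_restrictT _ measurable_abs_poincare_lty)).
(* On [N] the modulus of the sum is the pointwise limit of the moduli of the partial sums. *)
apply: (@measurable_fun_cvg _ (borel G) _ N
  (fun n g => normc (series (poincare_seq chi phi e g) n))) => [n|g gN].
  apply: (@measurable_funTS _ _ (borel G)).
  apply: complex_measurable_normc; apply: complex_measurable_sum => k.
  exact: complex_measurable_poincare_seq.
rewrite (poincare_seriesE Lambda_sub chi_unitary eP eP gN).
have cz : cvgn (series (poincare_seq chi phi e g)).
  apply: cvg_normc_series.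
  by rewrite (abs_poincareE Lambda_sub phi chi_unitary eP g eP).
apply: (cvg_comp (series (poincare_seq chi phi e g)) (@Normc.normc R)) cz _.
exact: normc_continuous.
Qed.

End poincare_measurable.

(** * Subadditive functions of the Poincare series *)

Section pointwise.
Context (R : realType) (G : topologicalGroupType).
Context (Gamma Lambda : groupClosed G) (Lambda_sub : {subset Lambda <= Gamma}).
Context (chi phi : G -> R[i]) (chi_unitary : unitary_character Gamma chi).
Context (e : nat -> option (coset_space Lambda)).
Hypothesis eP : enumerates (coset_pi Lambda @` [set` Gamma]) e.
Context (rho : R[i] -> R).
Hypotheses (rho_ge0 : forall z, 0 <= rho z) (rho0 : rho 0 = 0).
Hypothesis rho_norm : forall z, rho z = rho `|z|.
Hypothesis rho_sum : forall z : nat -> R[i]^o,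
  (\sum_(0 <= n <oo) (Normc.normc (z n))%:E < +oo)%E ->
  ((rho (limn (series z)))%:E <= \sum_(0 <= n <oo) (rho (z n))%:E)%E.

(** Extension by 0 turns an integral over the cosets of an invariant set [E] into one over the whole
    quotient, to which [unfolding] applies. *)
Definition rho_part (E : set G) : G -> \bar R :=
  (fun g => (rho (phi g))%:E) \_ E.

Lemma rho_part_ge0 E g : (0 <= rho_part E g)%E.
Proof. by rewrite /rho_part patchE; case: ifP => // _; rewrite lee_fin. Qed.

Lemma rho_poincare_le (E : set G) g :
  (forall n m x y, e n = Some x -> e m = Some y ->
     E (repr x * g)%g -> E (repr y * g)%g -> n = m) ->
  (abs_poincare phi e g < +oo)%E ->
  poincare_series Lambda Gamma chi phi g = 0 ->
  (\sum_(0 <= n <oo) (if e n is Some x then rho_part E (repr x * g)%g else 0) <=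
   \sum_(0 <= n <oo)
     (if e n is Some x then rho_part (~` E) (repr x * g)%g else 0))%E.
Proof.
move=> Einj goo P0.
have ge0 (A : set G) n :
    (0 <= if e n is Some x then rho_part A (repr x * g)%g else 0)%E.
  by case: (e n) => // x; exact: rho_part_ge0.
have [[k [x [ek Ex]]]|nE] := pselect (exists n x, e n = Some x /\ E (repr x * g)%g);
    last first.
  rewrite eseries0; first exact: nneseries_ge0.
  move=> n _ _; case en : (e n) => [x|//]; rewrite /rho_part patchE memNset//.
  by move=> Ex; apply: nE; exists n, x.
set z := poincare_seq chi phi e g.
have zoo : (\sum_(0 <= n <oo) (Normc.normc (z n))%:E < +oo)%E.
  by rewrite (abs_poincareE Lambda_sub phi chi_unitary eP g eP).
have rho_term n y : e n = Some y -> rho (z n) = rho (phi (repr y * g)%g).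
  move=> en; have yG := enumerates_mem Lambda_sub eP en.
  rewrite /z /poincare_seq en rho_norm.
  by rewrite (normr_poincare_term phi chi_unitary _ yG) -rho_norm.
(* Replacing the term in [E] by 0 keeps the indexing by [nat] and costs nothing, as [rho] vanishes
   at 0. *)
pose w n : R[i]^o := if n == k then 0 else z n.
have woo : (\sum_(0 <= n <oo) (Normc.normc (w n))%:E < +oo)%E.
  apply: le_lt_trans zoo; apply: lee_nneseries => n.
    by move=> _ _; rewrite lee_fin normc_ge0.
  move=> _; rewrite lee_fin /w; case: ifP => // _; rewrite Normc.normc0; exact: normc_ge0.
have limw : limn (series w) = - z k.
  apply: (cvg_lim (@norm_hausdorff _ _)).
  have -> : - z k = limn (series z) - z k.
    by rewrite -(poincare_seriesE Lambda_sub chi_unitary eP eP goo) P0 sub0r.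
  have cz : (fun n => series z n - z k) @ \oo --> limn (series z) - z k.
    apply: cvgB; last exact: cvg_cst.
    (* Absolute convergence makes the partial sums of [z] converge to the limit. *)
    exact: cvg_normc_series.
  apply: cvg_trans cz; apply: near_eq_cvg.
  (* From stage [k.+1] on, term [k] is included and the partial sums differ by exactly [z k]. *)
  exists k.+1 => // n /= kn.
  have kI : k \in index_iota 0 n by rewrite mem_index_iota.
  rewrite /series /= (bigD1_seq k)//= ?iota_uniq//.
  rewrite [LHS]addrC addKr [in RHS](bigD1_seq k)//= ?iota_uniq// /w eqxx add0r.
  by apply: eq_bigr => i /negbTE ->.
(* (M3) for [w] bounds [rho (- z k)]; by (M2) neither the sign nor the unitary factor in [z k]
   matters. *)
have := rho_sum woo; rewrite limw rho_norm normrN -rho_norm.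
rewrite (rho_term _ _ ek) => kle.
apply: (@le_trans _ _ (rho (phi (repr x * g)%g))%:E).
  apply: lime_le; first by apply: is_cvg_nneseries => n _ _; exact: ge0.
  apply: nearW => n.
  apply: (@le_trans _ _ (\sum_(0 <= i < n)
      (if i == k then (rho (phi (repr x * g)%g))%:E else 0))%E).
    apply: lee_sum => i _; case: eqP => [->|ik].
      by rewrite ek /rho_part patchE mem_set.
    case ei : (e i) => [y|//]; rewrite /rho_part patchE memNset//.
    by move=> Ey; apply: ik; exact: Einj ei ek Ey Ex.
  rewrite -big_mkcond big_nat1_eq; case: ifP => // _.
  by rewrite lee_fin.
apply: le_trans kle _; apply: lee_nneseries => n.
  by move=> _ _; rewrite lee_fin.
move=> _; rewrite /w; case: eqP => [->|nk]; first by rewrite rho0.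
case en : (e n) => [y|]; last by rewrite /z /poincare_seq en rho0.
rewrite (rho_term _ _ en) /rho_part patchE mem_set// => Ey.
by apply: nk; exact: Einj en ek Ey Ex.
Qed.

End pointwise.

Lemma pi_image_invariant (G : topologicalGroupType) (L : groupClosed G)
    (E : set G) (x : coset_space L) :
  (forall l g, l \in L -> E g -> E (l * g)%g) ->
  (coset_pi L @` E) x <-> E (repr x).
Proof.
move=> EL; split=> [[g Eg <-]|Ex]; last by exists (repr x) => //; exact: coset_pi_repr.
by have [l lL ->] := repr_coset_pi L g; exact: EL.
Qed.

Section rho_integral.
Context (R : realType) (G : topologicalGroupType).
Context (Gamma Lambda : groupClosed G) (Lambda_sub : {subset Lambda <= Gamma}).
Context (chi phi : G -> R[i]) (chi_unitary : unitary_character Gamma chi).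
Hypothesis phi_meas :
  measurable_fun [set: borel G] (phi : borel G -> borel R[i]^o).
Hypothesis F1 : forall l g, l \in Lambda -> phi (l * g)%g = chi l * phi g.
Context (rho : R[i] -> R).
Hypothesis rho_meas :
  measurable_fun [set: borel R[i]^o] (rho : borel R[i]^o -> R).
Hypothesis rho_norm : forall z, rho z = rho `|z|.
Context (E : set (borel G)) (mE : measurable E).
Hypothesis EL : forall l g, l \in Lambda -> E g -> E (l * g)%g.

Lemma measurable_rho_part :
  measurable_fun setT (rho_part phi rho E : borel G -> \bar R).
Proof.
apply: (proj1 (measurable_restrictT _ mE)).
apply: (@measurable_funTS _ _ (borel G)); apply/measurable_EFinP.
exact: (@measurableT_comp _ _ _ (borel G) (borel R[i]^o) R rho setT phi).
Qed.

Lemma rho_part_invariant l g : l \in Lambda ->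
  rho_part phi rho E (l * g)%g = rho_part phi rho E g.
Proof.
move=> lL; rewrite /rho_part !patchE.
have -> : ((l * g)%g \in E) = (g \in E).
  apply/idP/idP; rewrite !inE; last exact: EL.
  by rewrite -{2}(mulKg l g); apply: EL; rewrite gpredV.
case: ifP => // _; have [_ chi1] := chi_unitary.
by rewrite F1// rho_norm normrM chi1 ?mul1r -?rho_norm//; exact: Lambda_sub.
Qed.

Lemma integral_rho_part (nu : {measure set (borel (coset_space Lambda)) -> \bar R}) :
  (\int[nu]_(x in coset_pi Lambda @` E) (rho (phi (repr x)))%:E =
   \int[nu]_x rho_part phi rho E (repr x))%E.
Proof.
rewrite integral_mkcond; apply: eq_integral => x _.
rewrite /rho_part !patchE; congr (if _ then _ else _).
by apply/idP/idP; rewrite !inE pi_image_invariant.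
Qed.

End rho_integral.

Lemma measurable_saturation (G : topologicalGroupType) (L : groupClosed G)
    (C : set (borel G)) : countable [set` L] -> measurable C ->
  measurable ([set (l * c)%g | l in [set` L] & c in C] : set (borel G)).
Proof.
move=> /countable_enumerates[e [eL Le _]] mC.
rewrite (_ : [set _ | l in _ & c in _] = \bigcup_n
    (if e n is Some l then [set g | C (l^-1 * g)%g] else set0)).
  apply: bigcupT_measurable => n; case: (e n) => [l|]; last exact: measurable0.
  exact: measurable_mulgl.
apply/seteqP; split=> [_ [l lL [c Cc <-]]|g [n _]].
  by have [n en] := Le l lL; exists n => //; rewrite en /= mulKg.
case en : (e n) => [l|//] /= Cg; exists l; first exact: eL en.
by exists (l^-1 * g)%g => //; rewrite mulVKg.
Qed.

(** * Comparison of the two integrals over the fundamental domain *)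

Unset Implicit Arguments.

Theorem theorem3p2 (R : realType) (G : topologicalGroupType)
    (G_lc : locally_compact [set: G])
    (G_T2 : hausdorff_space G)
    (G_sc : @second_countable G)
    (G_unimodular : unimodular R G)
    (mu : {measure set (borel G) -> \bar R})
    (mu_haar : haar_measure mu)
    (Gamma : groupClosed G) (Gamma_discrete : discrete_subgroup Gamma)
    (Lambda : groupClosed G) (Lambda_sub : {subset Lambda <= Gamma})
    (muGamma : {measure set (borel (coset_space Gamma)) -> \bar R})
    (muGammaP : quotient_measure mu muGamma)
    (muLambda : {measure set (borel (coset_space Lambda)) -> \bar R})
    (muLambdaP : quotient_measure mu muLambda)
    (chi : G -> R[i]) (chi_unitary : unitary_character Gamma chi)
    (phi : G -> R[i])
    (phi_meas : measurable_fun [set: borel G] (phi : borel G -> borel R[i]^o))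
    (F1 : forall l g, l \in Lambda -> phi (l * g)%g = chi l * phi g)
    (F2 : muLambda.-integrable [set: coset_space Lambda]
            (fun x => (Normc.normc (phi (repr x)))%:E)) :
  (exists C : set (borel G), [/\ measurable C,
     [set (x * y^-1)%g | x in C & y in C] `&` [set` Gamma] `<=` [set` Lambda]
   & let LC := [set (l * c)%g | l in [set` Lambda] & c in C] in
     exists rho : R[i] -> R, [/\
       measurable_fun [set: borel R[i]^o] (rho : borel R[i]^o -> R),
       forall z, 0 <= rho z,
       [/\ rho 0 = 0,
         forall z, rho z = rho `|z|
       & forall z : nat -> R[i]^o,
           (\sum_(0 <= n <oo) (Normc.normc (z n))%:E < +oo)%E ->
           ((rho (limn (series z)))%:E <= \sum_(0 <= n <oo) (rho (z n))%:E)%E]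
     & (\int[muLambda]_(x in coset_pi Lambda @` (~` LC)) (rho (phi (repr x)))%:E
        < \int[muLambda]_(x in coset_pi Lambda @` LC)
            (rho (phi (repr x)))%:E)%E]]) ->
  (0 < \int[muGamma]_(x in [set: coset_space Gamma])
         (Normc.normc (poincare_series Lambda Gamma chi phi (repr x)))%:E)%E.
Proof.
move=> [C [mC C1 [rho [rho_meas rho_ge0 [rho0 rho_norm rho_sum]]]]].
set LC := [set (l * c)%g | l in [set` Lambda] & c in C] => rho_lt.
have [mu_radon _ mu_inv] := mu_haar.
have Lambda_discrete := discrete_subset Lambda_sub Gamma_discrete.
have [V [sV _ VT]] := exists_slices G_lc G_sc Gamma_discrete.
pose F : set (borel G) := slice_domain Gamma V.
have fF : fundamental_domain Gamma F := slice_domain_fundamental sV VT.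
have [mF _ _] := fF.
have [e eP] : exists e, enumerates (coset_pi Lambda @` [set` Gamma]) e.
  apply: countable_enumerates; apply: card_le_trans (card_image_le _ _) _.
  exact: discrete_countable G_lc G_sc Gamma_discrete.
have mLC : measurable (LC : set (borel G)).
  apply: measurable_saturation => //.
  exact: discrete_countable G_lc G_sc Lambda_discrete.
have LCL l g : l \in Lambda -> LC g -> LC (l * g)%g.
  move=> lL [l' l'L [c Cc <-]]; exists (l * l')%g; first exact: gpredM.
  by exists c => //; rewrite mulgA.
have nLCL l g : l \in Lambda -> (~` LC) g -> (~` LC) (l * g)%g.
  move=> lL nLC LClg; apply: nLC; rewrite -(mulKg l g); apply: LCL => //.
  by rewrite gpredV.
(* If [x g = l c] and [y g = l' c'] for representatives x, y, then c/c' is a product of elements of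
   [Gamma], so (C1) puts it in [Lambda]. Hence x/y is in [Lambda] too, and the two cosets
   coincide. *)
have LCinj g n m x y : e n = Some x -> e m = Some y ->
    LC (repr x * g)%g -> LC (repr y * g)%g -> n = m.
  move=> en em [l lL [c Cc lc]] [l' l'L [c' Cc' lc']].
  suff xy : x = y by subst y; case: eP => _ _; apply; [exact: en|exact: em].
  rewrite -(coset_pi_repr x) -(coset_pi_repr y); apply/coset_piP.
  have xyE : (repr x / repr y = l * (c / c') / l')%g.
    have -> : repr x = (l * c / g)%g by rewrite lc mulgK.
    have -> : repr y = (l' * c' / g)%g by rewrite lc' mulgK.
    by rewrite mulgKA invgM !mulgA.
  have ccE : (c / c' = l^-1 * (repr x / repr y) * l')%g.
    by rewrite xyE mulgA mulgVK mulKg.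
  have ccL : (c / c')%g \in Lambda.
    apply: C1; split; first by exists c => //; exists c'.
    rewrite /= ccE; apply: gpredM; last exact: Lambda_sub.
    apply: gpredM; first by rewrite gpredV; exact: Lambda_sub.
    by apply: gpredF; [exact: (enumerates_mem Lambda_sub eP en)|
                       exact: (enumerates_mem Lambda_sub eP em)].
  by rewrite xyE; apply: gpredF => //; exact: gpredM.
have unfoldP := unfolding G_lc G_T2 G_sc mu_radon mu_inv Lambda_sub eP
  Gamma_discrete muLambdaP fF.
have rhoE E : measurable (E : set (borel G)) ->
    (forall l g, l \in Lambda -> E g -> E (l * g)%g) ->
    (\int[muLambda]_(x in coset_pi Lambda @` E) (rho (phi (repr x)))%:E =
     \int[mu]_(g in F) \sum_(0 <= n <oo)
       (if e n is Some x then rho_part phi rho E (repr x * g)%g else 0))%E.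
  move=> mE EL; rewrite (integral_rho_part phi rho EL muLambda) unfoldP//.
  - exact: measurable_rho_part.
  - by move=> l g; exact: (rho_part_invariant Lambda_sub chi_unitary).
  - by move=> g; exact: rho_part_ge0.
have msum E : measurable (E : set (borel G)) ->
    measurable_fun F ((fun g => \sum_(0 <= n <oo)
      (if e n is Some x then rho_part phi rho E (repr x * g)%g else 0))%E
      : borel G -> \bar R).
  move=> mE; rewrite (_ : (fun g => _) = (fun g : borel G =>
    \sum_(0 <= n <oo | n \in xpredT)
      (if e n is Some x then rho_part phi rho E (repr x * g)%g else 0))%E);
    last first.
    by apply/funext => g; apply: eq_eseriesl => n.
  apply: ge0_emeasurable_sum => n.
    by move=> g _ _; case: (e n) => // x; exact: rho_part_ge0.
  move=> _; case: (e n) => [x|]; last exact: measurable_cst.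
  apply: (@measurable_funTS _ _ (borel G)).
  by apply: (measurable_translate (repr x)); exact: measurable_rho_part.
(* By unfolding, (F2) says that [abs_poincare] has finite integral over [F]. *)
have abs_ae : {ae mu, forall g, F g -> (abs_poincare phi e g < +oo)%E}.
  have mabs := measurable_abs_poincare e phi_meas.
  have : mu.-integrable F (abs_poincare phi e).
    apply/integrableP; split; first exact: (@measurable_funTS _ _ (borel G)).
    under eq_integral.
      move=> g _; rewrite gee0_abs; last first.
        apply: nneseries_ge0 => n _ _; case: (e n) => // x.
        by rewrite lee_fin normc_ge0.
      over.
    have /integrableP[_] := F2.
    under [X in (X < _)%E -> _]eq_integral do
      rewrite gee0_abs ?lee_fin ?normc_ge0//.
    rewrite (unfoldP (fun g => (Normc.normc (phi g))%:E))//.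
    - by apply/measurable_EFinP; exact: measurable_normc_phi.
    - move=> l g lL; rewrite F1// Normc.normcM.
      have [_ chi1] := chi_unitary.
      by have /(congr1 (@complex.Re R)) /= -> := chi1 _ (Lambda_sub _ lL); rewrite mul1r.
    - by move=> g; rewrite lee_fin normc_ge0.
  move=> /(integrable_ae mF); apply: filterS => g /[apply].
  by rewrite fin_numE => /andP[_]; rewrite ltey.
rewrite ltNge; apply/negP => int_le0.
have norm_ae : {ae mu, forall g, F g -> poincare_norm Gamma chi phi e g = 0}.
  have mn := measurable_poincare_norm Lambda_sub chi_unitary eP phi_meas.
  have norm_ge0 g : 0 <= poincare_norm Gamma chi phi e g.
    by rewrite /poincare_norm; case: ifP => // _; exact: normc_ge0.
  have int0 : (\int[mu]_(g in F) `|(poincare_norm Gamma chi phi e g)%:E| = 0)%E.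
    under eq_integral do rewrite gee0_abs ?lee_fin ?norm_ge0//.
    apply/eqP; rewrite eq_le integral_ge0 ?andbT; last first.
      by move=> g _; rewrite lee_fin.
    rewrite -(quotient_integralE G_lc G_T2 G_sc mu_radon mu_inv Gamma_discrete
      muGammaP fF (f := fun g => (poincare_norm Gamma chi phi e g)%:E)).
    (* [poincare_norm] lies below the modulus of the series everywhere, so its integral over the
       quotient is at most 0. *)
    - apply: le_trans int_le0; apply: ge0_le_integralT => x; rewrite lee_fin//.
      by rewrite /poincare_norm; case: ifP => // _; exact: normc_ge0.
    - exact/measurable_EFinP.
    (* The set of absolute convergence is itself invariant, and off it both values are 0. *)
    - move=> c g cG; rewrite /poincare_norm.
      rewrite (abs_poincare_act Lambda_sub chi_unitary F1 eP g cG).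
      case: ifP => // goo.
      by rewrite (normc_poincare_act Lambda_sub chi_unitary F1 eP cG goo).
    - by move=> g; rewrite lee_fin.
  have /(ae_eq_integral_abs mu mF) := int0.
  move=> h; have mnF : measurable_fun F (EFin \o poincare_norm Gamma chi phi e).
    by apply/measurable_EFinP; exact: (@measurable_funTS _ _ (borel G)).
  by move/h: mnF; apply: filterS => g /[apply] -[].
move: rho_lt; apply/negP; rewrite -leNgt.
rewrite !rhoE//; last exact: measurableC.
(* Both sides of (C2) are now integrals over [F]; a pointwise inequality almost everywhere reverses
   the strict one. *)
apply: ae_ge0_le_integral => //.
- by move=> g _; apply: nneseries_ge0 => n _ _; case: (e n) => // x; exact: rho_part_ge0.
- exact: msum.
- by move=> g _; apply: nneseries_ge0 => n _ _; case: (e n) => // x; exact: rho_part_ge0.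
- by apply: msum; exact: measurableC.
apply: filterS2 abs_ae norm_ae => g abs_g norm_g Fg.
have goo := abs_g Fg.
apply: (rho_poincare_le Lambda_sub chi_unitary eP) => //.
- by move=> n m x y; exact: LCinj.
- by have := norm_g Fg; rewrite /poincare_norm goo => /Normc.eq0_normc.
Qed.
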